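(* Suppose that $\mu\in\mathcal{P}_m(\mu_T)$ and $\zeta\in\mathbb{C}\setminus[-1,1]$, and let $Q_n$ be the polar polynomials (normalized as in the context). Then there are functions $\Psi_n(u)$, $|u|>1$, such that, with $z=\frac12(u+u^{-1})$, $|u|>1$, and $u_\zeta=\varphi(\zeta)$, $$(z-\zeta)Q_n(z)=\frac{u^{n+1}}{2^{n+1}(n+1)}\Psi_n(u)-\frac{u_\zeta^{n+1}}{2^{n+1}(n+1)}\Psi_n(u_\zeta),$$ and, as $n\to\infty$, $$\Psi_n(u)\to\left(1-\frac{1}{u^2}\right)\bigl(D(\rho,0)\bigr)^{-1}D(\rho,u^{-1}),$$ uniformly for $z=\frac12(u+u^{-1})$ in any compact subset $K$ of $\overline{\mathbb{C}}\setminus[-1,1]$.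
   Context: $d\mu_T(x)=\frac{dx}{\sqrt{1-x^2}}$ on $[-1,1]$. $\mathcal{P}_m(\mu_T)$ is the class of finite positive Borel measures on $[-1,1]$ of the form $d\mu(x)=\frac{d\mu_T(x)}{\rho(x)}$ with $\rho(z)=r\prod_{i=1}^m(z-\nu_i)$ a polynomial nonnegative on $[-1,1]$. Let $P_n$ be the $n$th monic orthogonal polynomial with respect to $\mu$. The polar polynomial $Q_n$ is the polynomial of degree $n$ orthogonal with respect to $(\mathcal{L}_\zeta,\mu)$, $\mathcal{L}_\zeta[f](x)=f(x)+(x-\zeta)f'(x)=((x-\zeta)f(x))'$, i.e. $\int\mathcal{L}_\zeta[Q_n]P\,d\mu=0$ for all polynomials $P$ with $\deg P\le n-1$; here it is normalized so that $(z-\zeta)Q_n(z)=\int_\zeta^zP_n(t)\,dt$. $\varphi(z)=z+\sqrt{z^2-1}$ with the branch such that $|\varphi(z)|>1$ for $z\in\mathbb{C}\setminus[-1,1]$. The Szegő function is, for $|w|<1$, $$D(\rho,w)=\exp\left[\frac1{4\pi}\int_{-\pi}^{\pi}\log\rho(\cos t)\,\frac{1+we^{-it}}{1-we^{-it}}\,dt\right].$$ *)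

(* Defs.v *)
From HB Require Import structures.
From mathcomp Require Import all_boot all_order all_algebra.
From mathcomp Require Import complex.
From mathcomp Require Import all_classical all_reals all_analysis.

Set Implicit Arguments.
Unset Strict Implicit.
Unset Printing Implicit Defensive.

Import Order.TTheory GRing.Theory Num.Theory.
Import numFieldNormedType.Exports.

Local Open Scope classical_set_scope.
Local Open Scope ring_scope.
Local Open Scope complex_scope.

Definition interval_pm1 (R : realType) : set R[i] :=
  [set x%:C | x in `[(-1 : R), 1]].

(* R[i]^o is R[i] with the topology of its (R[i]-valued) modulus. *)
Definition riemann_sphere (R : realType) : topologicalType :=
  one_point_compactification R[i]^o.

Definition cexp (R : realType) (z : R[i]) : R[i] :=
  (expR (complex.Re z) * cos (complex.Im z)) +i*
  (expR (complex.Re z) * sin (complex.Im z)).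

Definition cintegral d (T : measurableType d) (R : realType)
    (mu : {measure set T -> \bar R}) (D : set T) (f : T -> R[i]) : R[i] :=
  (Rintegral mu D (fun x => complex.Re (f x))) +i*
  (Rintegral mu D (fun x => complex.Im (f x))).

(* Integral along the straight segment from a to b; for the polynomial
   integrands considered here it is the integral along any path. *)
Definition segment_integral (R : realType) (a b : R[i]) (f : R[i] -> R[i]) :
    R[i] :=
  (b - a) * cintegral (@lebesgue_measure R) `[0, 1]
              (fun s : R => f (a + s%:C * (b - a))).

Definition chebyshev_density (R : realType) (x : R) : R :=
  (Num.sqrt (1 - x ^+ 2))^-1.

(* mu belongs to P_m(mu_T) with denominator rho. Since mu is finite, rho cannot
   vanish on [-1, 1], so the convention 0^-1 = 0 only affects the null set
   {-1, 1}; r != 0 excludes the zero measure. A polynomial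
   r * prod (z - nu_i) that is nonnegative on [-1, 1] has real coefficients,
   hence rho : {poly R}. *)
Definition in_P_muT (R : realType) (m : nat) (rho : {poly R})
    (mu : {finite_measure set (measurableTypeR R) -> \bar R}) : Prop :=
  [/\ exists (r : R) (nu : 'I_m -> R[i]), r != 0 /\
        map_poly (real_complex R) rho =
          r%:C *: \prod_(i < m) ('X - (nu i)%:P),
      forall x : R, x \in `[-1, 1] -> 0 <= rho.[x] &
      forall A : set (measurableTypeR R), measurable A ->
        mu A = (\int[@lebesgue_measure R]_(x in A `&` `[(-1)%R, 1%R])
                  (chebyshev_density x / rho.[x])%:E)%E].

Definition poly_integral (R : realType)
    (mu : {finite_measure set (measurableTypeR R) -> \bar R})
    (p : {poly R[i]}) : R[i] :=
  cintegral mu `[-1, 1] (fun x : R => p.[x%:C]).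

Definition monic_orthogonal (R : realType)
    (mu : {finite_measure set (measurableTypeR R) -> \bar R})
    (n : nat) (P : {poly R[i]}) : Prop :=
  [/\ P \is monic, size P = n.+1 &
      forall q : {poly R[i]}, (size q <= n)%N -> poly_integral mu (P * q) = 0].

Definition polar_op (R : realType) (zeta : R[i]) (f : {poly R[i]}) :
    {poly R[i]} :=
  f + ('X - zeta%:P) * f^`().

Definition polar_polynomial (R : realType)
    (mu : {finite_measure set (measurableTypeR R) -> \bar R}) (zeta : R[i])
    (n : nat) (P Q : {poly R[i]}) : Prop :=
  [/\ size Q = n.+1,
      forall q : {poly R[i]}, (size q <= n)%N ->
        poly_integral mu (polar_op zeta Q * q) = 0 &
      forall z : R[i],
        (z - zeta) * Q.[z] = segment_integral zeta z (fun t => P.[t])].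

(* The principal root sqrtC is corrected by a sign so that |phi z| > 1 off
   [-1, 1]; the two candidates are mutually inverse. *)
Definition phi (R : realType) (z : R[i]) : R[i] :=
  let s := sqrtC (z ^+ 2 - 1) in
  if 1 < `|z + s| then z + s else z - s.

Definition szego (R : realType) (rho : R -> R) (w : R[i]) : R[i] :=
  cexp (((4 * pi)^-1 : R)%:C *
    cintegral (@lebesgue_measure R) `[- pi, pi]
      (fun t : R => (ln (rho (cos t)))%:C *
         ((1 + w * cexp (- (t *i))) / (1 - w * cexp (- (t *i)))))).

Definition joukowski (R : realType) (u : R[i]) : R[i] := (u + u^-1) / 2.

Definition sphere_joukowski (R : realType) (u : riemann_sphere R) :
    riemann_sphere R :=
  if u is Some v then Some (joukowski v) else None.

(* {|u| > 1} together with the point at infinity None. *)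
Definition exterior_disc (R : realType) : set (riemann_sphere R) :=
  [set u | if u is Some v then 1 < `|v : R[i]| else True].

Definition sphere_inv (R : realType) (u : riemann_sphere R) : R[i] :=
  if u is Some v then (v : R[i])^-1 else 0.

(* (1 - u^-2) D(rho, 0)^-1 D(rho, u^-1), with u^-1 = 0 at u = infinity. *)
Definition psi_limit (R : realType) (rho : {poly R}) (u : riemann_sphere R) :
    R[i] :=
  (1 - sphere_inv u ^+ 2) * (szego (horner rho) 0)^-1 *
  szego (horner rho) (sphere_inv u).

(* Main.v *)
Require Import Defs.
From HB Require Import structures.
From mathcomp Require Import all_boot all_order all_algebra.
From mathcomp Require Import complex.
From mathcomp Require Import all_classical all_reals all_analysis.
From mathcomp Require Import measurable_realfun.
From mathcomp Require Import zify ring lra.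

(** Write [z = (u + u^-1) / 2] with [|u| > 1], and [w = u^-1].

    A polynomial [rho] positive on the interval factors as
    [rho z = c * h u * h u^-1] with [h] a polynomial, [h 0 = 1], without zeros
    in the closed unit disc ([fejer_riesz], where [h] is [outer]).  After the
    substitution [x = cos t] the integral of a polynomial against [mu] is half
    the integral over the circle of its quotient by [rho]
    ([poly_integral_cos]).  As [1 / h] is analytic in the disc, the mean value
    property makes [2 ^- n * (u ^+ n * h u^-1 + u ^- n * h u)], which is a
    monic polynomial of degree [n] in [z], orthogonal to all polynomials of
    smaller degree; hence it is [P n] as soon as [n >= m + 2]
    ([monic_orthogonal_unique]).  That [rho] has no zero on the interval
    follows from the finiteness of [mu] ([rho_gt0]).

    This expression can be integrated term by term in Chebyshev polynomials:
    a primitive of [P n] is [u ^+ n.+1 / (2 ^+ n.+1 * n.+1)] times a polynomial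
    in [w] ([bs_primitive_joukowski]).  Its coefficients are those of
    [(1 - w ^+ 2) * h w] up to factors tending to one, apart from terms of
    degree at least [n], so it converges to [(1 - w ^+ 2) * h w]
    uniformly for [|w| <= q] with [q < 1] ([bs_psi_cvg]).  This polynomial is
    [Psi n]; since [(z - zeta) * Q n z] is the increment of any primitive of
    [P n] from [zeta = joukowski (phi zeta)] to [z], the first formula holds
    exactly.

    The limit is identified by taking logarithms on the circle: [ln rho] is a
    constant plus [log (h u) + log (h u^-1)], and the kernel of the Szego
    function reproduces twice the analytic part, kills the other and halves
    the result, so that [D(rho, w) = D(rho, 0) * h w] ([szego_ratio]).

    Finally a compact subset of the sphere which avoids the interval lies
    outside an ellipse with foci [-1] and [1], so that [|w|] is at most some
    [q < 1] on it ([compact_exterior]). *)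

Set Implicit Arguments.
Unset Strict Implicit.
Unset Printing Implicit Defensive.

Import Order.TTheory GRing.Theory Num.Theory.
Import numFieldNormedType.Exports.

Local Open Scope classical_set_scope.
Local Open Scope ring_scope.
Local Open Scope complex_scope.
Import Normc.

Local Notation Re := complex.Re.
Local Notation Im := complex.Im.

(** * Modulus and exponential of complex numbers *)
Section ComplexModulus.
Context {R : realType}.
Implicit Types z w : R[i].

Lemma norm_normc z : `|z| = (normc z)%:C.
Proof. by case: z => a b; rewrite normc_def. Qed.

Lemma normc_ge0 z : 0 <= normc z.
Proof. by rewrite -ler0c -norm_normc normr_ge0. Qed.

Lemma normcR (x : R) : normc x%:C = `|x|.
Proof. by rewrite /= expr0n /= addr0 sqrtr_sqr. Qed.

Lemma normc_sqr z : normc z ^+ 2 = Re z ^+ 2 + Im z ^+ 2.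
Proof. by case: z => a b /=; rewrite sqr_sqrtr// addr_ge0 ?sqr_ge0. Qed.

Lemma normcX z n : normc (z ^+ n) = normc z ^+ n.
Proof.
by elim: n => [|n IH]; rewrite ?expr0 ?normc1// !exprS normcM IH.
Qed.

Lemma normc_conj z : normc z^* = normc z.
Proof. by case: z => a b /=; rewrite sqrrN. Qed.

Lemma normc_eq0 z : (normc z == 0) = (z == 0).
Proof. by apply/eqP/eqP => [/eq0_normc//|->]; rewrite normc0. Qed.

Lemma normc_gt0 z : (0 < normc z) = (z != 0).
Proof. by rewrite lt_def normc_ge0 andbT normc_eq0. Qed.

Lemma normc_Re z : `|Re z| <= normc z.
Proof. by rewrite -lecR -norm_normc normc_ge_Re. Qed.

Lemma normc_Im z : `|Im z| <= normc z.
Proof.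
case: z => a b /=; rewrite -[`|b|]sqrtr_sqr ler_wsqrtr//.
by rewrite lerDr sqr_ge0.
Qed.

Lemma normc_le_ReIm z : normc z <= `|Re z| + `|Im z|.
Proof.
rewrite -(@ler_pXn2r _ 2) ?nnegrE ?addr_ge0 ?normc_ge0//.
rewrite normc_sqr sqrrD !real_normK ?num_real// addrAC lerDl.
by rewrite mulrn_wge0// mulr_ge0.
Qed.

Lemma le_normc_sub z w : normc (z - w) <= normc z + normc w.
Proof. by rewrite -(normcN w) le_normcD. Qed.

Lemma normc_sum (I : Type) (r : seq I) (P : pred I) (F : I -> R[i]) :
  normc (\sum_(i <- r | P i) F i) <= \sum_(i <- r | P i) normc (F i).
Proof.
rewrite -lecR -norm_normc (le_trans (ler_norm_sum _ _ _))// rmorph_sum/=.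
by under eq_bigr do rewrite norm_normc.
Qed.

Lemma cReD z w : Re (z + w) = Re z + Re w. Proof. by case: z w => ? ? []. Qed.
Lemma cImD z w : Im (z + w) = Im z + Im w. Proof. by case: z w => ? ? []. Qed.
Lemma cReN z : Re (- z) = - Re z. Proof. by case: z. Qed.
Lemma cImN z : Im (- z) = - Im z. Proof. by case: z. Qed.
Lemma cReM z w : Re (z * w) = Re z * Re w - Im z * Im w.
Proof. by case: z w => ? ? []. Qed.
Lemma cImM z w : Im (z * w) = Re z * Im w + Im z * Re w.
Proof. by case: z w => ? ? [? ?] /=; rewrite [X in _ + X]mulrC. Qed.

Lemma cReV z : Re z^-1 = Re z / (Re z ^+ 2 + Im z ^+ 2).
Proof. by case: z. Qed.
Lemma cImV z : Im z^-1 = - Im z / (Re z ^+ 2 + Im z ^+ 2).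
Proof. by case: z => a b /=; rewrite mulNr. Qed.

Lemma complex_eq z w : Re z = Re w -> Im z = Im w -> z = w.
Proof. by case: z w => ? ? [? ?] /= -> ->. Qed.

Lemma ReImsq_neq0 z : z != 0 -> Re z ^+ 2 + Im z ^+ 2 != 0.
Proof. by rewrite -normc_sqr sqrf_eq0 normc_eq0. Qed.

Lemma one_sub_neq0 z : normc z < 1 -> 1 - z != 0.
Proof.
by apply: contraTneq => /eqP; rewrite subr_eq0 => /eqP <-; rewrite normc1 ltxx.
Qed.

Lemma cexp0 : cexp (0 : R[i]) = 1.
Proof. by rewrite /cexp/= expR0 cos0 sin0 mulr1 mulr0. Qed.

Lemma cexpD z w : cexp (z + w) = cexp z * cexp w.
Proof.
apply: complex_eq; rewrite ?cReM ?cImM /cexp /= cReD cImD expRD.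
  by rewrite cosD; ring.
by rewrite sinD; ring.
Qed.

Lemma cexp_sum (I : Type) (r : seq I) (F : I -> R[i]) :
  cexp (\sum_(i <- r) F i) = \prod_(i <- r) cexp (F i).
Proof. by apply: (big_morph _ cexpD cexp0). Qed.

End ComplexModulus.

(** * The unit circle *)
Section CircleParam.
Context {R : realType}.

Definition circ (t : R) : R[i] := cexp (t *i).

Lemma circE t : circ t = cos t +i* sin t.
Proof. by rewrite /circ /cexp /= expR0 !mul1r. Qed.

Lemma circN t : circ (- t) = (circ t)^*.
Proof. by rewrite !circE cosN sinN. Qed.

Lemma cexpNi t : cexp (- (t *i)) = circ (- t) :> R[i].
Proof. by rewrite /circ; congr cexp; apply: complex_eq; rewrite //= oppr0. Qed.

Lemma normc_circ t : normc (circ t) = 1.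
Proof. by rewrite circE /= cos2Dsin2 sqrtr1. Qed.

Lemma circ_neq0 t : circ t != 0.
Proof. by rewrite -normc_eq0 normc_circ oner_eq0. Qed.

Lemma circV t : (circ t)^-1 = circ (- t).
Proof.
apply: complex_eq; rewrite circN ?cReV ?cImV circE /= cos2Dsin2 divr1//.
Qed.

Lemma circX t n : circ t ^+ n = circ (n%:R * t).
Proof.
elim: n => [|n IH]; first by rewrite expr0 mul0r /circ cexp0.
rewrite exprS IH /circ -cexpD; congr cexp; apply: complex_eq.
  by rewrite cReD /= addr0.
by rewrite cImD /= -natr1 mulrDl mul1r addrC.
Qed.

Lemma joukowski_circ t : joukowski (circ t) = (cos t)%:C.
Proof.
rewrite /joukowski circV circN circE.
have -> : (cos t +i* sin t) + (cos t +i* sin t)^* = (cos t * 2)%:C.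
  by apply: complex_eq; rewrite /= ?subrr ?mulr_natr ?mulr2n.
by rewrite rmorphM /= rmorph_nat mulfK// pnatr_eq0.
Qed.

End CircleParam.

(** * Coordinatewise continuity *)
Section ContinuousComplex.
Context {R : realType}.
Implicit Types g h : R -> R[i].

Lemma contD (T : topologicalType) (f1 f2 : T -> R) :
  continuous f1 -> continuous f2 -> continuous (fun t => f1 t + f2 t).
Proof. by move=> c1 c2 t; apply: cvgD; [exact: c1|exact: c2]. Qed.

Lemma contN (T : topologicalType) (f : T -> R) :
  continuous f -> continuous (fun t => - f t).
Proof. by move=> cf t; apply: cvgN; exact: cf. Qed.

Lemma contB (T : topologicalType) (f1 f2 : T -> R) :
  continuous f1 -> continuous f2 -> continuous (fun t => f1 t - f2 t).
Proof. by move=> c1 c2; apply: contD => //; exact: contN. Qed.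

Lemma contM (T : topologicalType) (f1 f2 : T -> R) :
  continuous f1 -> continuous f2 -> continuous (fun t => f1 t * f2 t).
Proof. by move=> c1 c2 t; apply: cvgM; [exact: c1|exact: c2]. Qed.

Lemma contV (T : topologicalType) (f : T -> R) :
  (forall t, f t != 0) -> continuous f -> continuous (fun t => (f t)^-1).
Proof. by move=> f0 cf t; apply: cvgV => //; exact: cf. Qed.

(** Coordinatewise continuity: the complex integral is defined coordinatewise,
    so this is the form of continuity which integrability needs. *)
Definition ccont g :=
  continuous (fun t => Re (g t)) /\ continuous (fun t => Im (g t)).

Lemma ccont_cst (c : R[i]) : ccont (fun=> c).
Proof. by split=> t; exact: cvg_cst. Qed.

Lemma ccontR (f : R -> R) : continuous f -> ccont (fun t => (f t)%:C).
Proof. by move=> cf; split=> //= t; exact: cvg_cst. Qed.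

Lemma ccontD g h : ccont g -> ccont h -> ccont (fun t => g t + h t).
Proof.
move=> [g1 g2] [h1 h2]; split.
  by under eq_fun do rewrite cReD; exact: contD.
by under eq_fun do rewrite cImD; exact: contD.
Qed.

Lemma ccontN g : ccont g -> ccont (fun t => - g t).
Proof.
move=> [g1 g2]; split.
  by under eq_fun do rewrite cReN; exact: contN.
by under eq_fun do rewrite cImN; exact: contN.
Qed.

Lemma ccontB g h : ccont g -> ccont h -> ccont (fun t => g t - h t).
Proof. by move=> cg ch; apply: ccontD => //; exact: ccontN. Qed.

Lemma ccontM g h : ccont g -> ccont h -> ccont (fun t => g t * h t).
Proof.
move=> [g1 g2] [h1 h2]; split.
  by under eq_fun do rewrite cReM; apply: contB; exact: contM.
by under eq_fun do rewrite cImM; apply: contD; exact: contM.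
Qed.

Lemma ccontV g : (forall t, g t != 0) -> ccont g -> ccont (fun t => (g t)^-1).
Proof.
move=> g0 [g1 g2].
have cd : continuous (fun t => (Re (g t) ^+ 2 + Im (g t) ^+ 2)^-1).
  apply: contV => [t|]; first by rewrite ReImsq_neq0.
  by apply: contD; under eq_fun do rewrite expr2; exact: contM.
split.
  by under eq_fun do rewrite cReV; exact: contM.
by under eq_fun do rewrite cImV; apply: contM => //; exact: contN.
Qed.

Lemma ccont_poly (p : {poly R[i]}) g : ccont g -> ccont (fun t => p.[g t]).
Proof.
move=> cg; elim/poly_ind: p => [|p c IH].
  by under eq_fun do rewrite horner0; exact: ccont_cst.
under eq_fun do rewrite hornerMXaddC.
by apply: ccontD; [exact: ccontM|exact: ccont_cst].
Qed.

Lemma ccontX g n : ccont g -> ccont (fun t => g t ^+ n).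
Proof.
move=> cg; have := ccont_poly 'X^n cg.
by under eq_fun do rewrite hornerXn.
Qed.

Lemma ccont_sum (I : Type) (r : seq I) (F : I -> R -> R[i]) :
  (forall i, ccont (F i)) -> ccont (fun t => \sum_(i <- r) F i t).
Proof.
move=> cF; elim: r => [|i r IH].
  by under eq_fun do rewrite big_nil; exact: ccont_cst.
by under eq_fun do rewrite big_cons; exact: ccontD.
Qed.

Lemma ccont_comp g (f : R -> R) : continuous f -> ccont g -> ccont (g \o f).
Proof.
move=> cf [g1 g2]; split=> t.
  by apply: (@continuous_comp _ _ _ f (fun s => Re (g s)));
     [exact: cf|exact: g1].
by apply: (@continuous_comp _ _ _ f (fun s => Im (g s)));
   [exact: cf|exact: g2].
Qed.

Lemma ccont_circ : ccont (@circ R).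
Proof.
split=> t; under eq_fun do rewrite circE /=;
exact: continuous_cos || exact: continuous_sin.
Qed.

End ContinuousComplex.

(** * Complex integrals over segments *)
Section SegmentIntegrals.
Context {R : realType}.
Implicit Types (f : R -> R) (g h : R -> R[i]) (a b : R).

Local Notation leb := (@lebesgue_measure R).

Lemma continuous_segment_integrable f a b :
  continuous f -> leb.-integrable `[a, b] (EFin \o f).
Proof.
move=> cf; apply: continuous_compact_integrable; first exact: segment_compact.
exact: continuous_subspaceT.
Qed.

Lemma Rintegral_FTC (F f : R -> R) a b : a < b -> continuous f ->
  (forall x : R, is_derive x (1 : R) F (f x)) ->
  Rintegral leb `[a, b] f = F b - F a.
Proof.
move=> ab cf dF; rewrite /Rintegral (@continuous_FTC2 _ f F) ?EFinN//.
- exact: continuous_subspaceT.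
- have cF : continuous F.
    by move=> x; apply/differentiable_continuous/derivable1_diffP; case: (dF x).
  split=> [x _||].
  + by case: (dF x).
  + exact/cvg_at_right_filter/cF.
  + exact/cvg_at_left_filter/cF.
- by move=> x _; rewrite derive1E; apply: derive_val.
Qed.

Lemma Rintegral_oppr f a : 0 <= a -> continuous f ->
  Rintegral leb `[- a, a] (fun t => f (- t)) = Rintegral leb `[- a, a] f.
Proof.
move=> a0 cf; rewrite /Rintegral; congr fine.
have := @integration_by_substitution_oppr R f (- a) a.
rewrite opprK => -> //; last exact: continuous_subspaceT.
by rewrite lerNl (le_trans _ a0)// oppr_le0.
Qed.

Notation cint a b g := (cintegral leb `[a, b] g).

Lemma eq_cint a b g h : g =1 h -> cint a b g = cint a b h.
Proof. by move=> gh; congr (cint a b _); exact/funext. Qed.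

Lemma cintD a b g h : ccont g -> ccont h ->
  cint a b (fun t => g t + h t) = cint a b g + cint a b h.
Proof.
move=> [g1 g2] [h1 h2]; apply: complex_eq; rewrite ?cReD ?cImD /=.
  under eq_Rintegral do rewrite cReD.
  by apply: RintegralD => //; exact: continuous_segment_integrable.
under eq_Rintegral do rewrite cImD.
by apply: RintegralD => //; exact: continuous_segment_integrable.
Qed.

Lemma cintZ a b (c : R[i]) g : ccont g ->
  cint a b (fun t => c * g t) = c * cint a b g.
Proof.
move=> [g1 g2]; apply: complex_eq; rewrite ?cReM ?cImM /=.
  under eq_Rintegral do rewrite cReM.
  rewrite RintegralB ?RintegralZl//; try exact: continuous_segment_integrable.
    by apply: (@continuous_segment_integrable (fun t => Re c * Re (g t)));
       apply: contM => // t; exact: cvg_cst.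
  by apply: (@continuous_segment_integrable (fun t => Im c * Im (g t)));
     apply: contM => // t; exact: cvg_cst.
under eq_Rintegral do rewrite cImM.
rewrite RintegralD ?RintegralZl//; try exact: continuous_segment_integrable.
  by apply: (@continuous_segment_integrable (fun t => Re c * Im (g t)));
     apply: contM => // t; exact: cvg_cst.
by apply: (@continuous_segment_integrable (fun t => Im c * Re (g t)));
   apply: contM => // t; exact: cvg_cst.
Qed.

Lemma cintB a b g h : ccont g -> ccont h ->
  cint a b (fun t => g t - h t) = cint a b g - cint a b h.
Proof.
move=> cg ch; under eq_cint do rewrite -mulN1r.
rewrite cintD ?cintZ ?mulN1r//; apply: ccontM => //; exact: ccont_cst.
Qed.

Lemma cint_cst a b (c : R[i]) : a <= b -> cint a b (fun=> c) = (b - a)%:C * c.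
Proof.
move=> ab; apply: complex_eq; rewrite ?cReM ?cImM /=;
by rewrite Rintegral_cst//= lebesgue_measure_itv/= lte_fin;
   case: ltgtP ab => //= [_ _|-> _]; rewrite ?subrr; ring.
Qed.

Lemma cint_sum a b (I : Type) (r : seq I) (F : I -> R -> R[i]) : a <= b ->
  (forall i, ccont (F i)) ->
  cint a b (fun t => \sum_(i <- r) F i t) = \sum_(i <- r) cint a b (F i).
Proof.
move=> ab cF; elim: r => [|i r IH].
  by under eq_cint do rewrite big_nil; rewrite big_nil cint_cst// mulr0.
under eq_cint do rewrite big_cons.
by rewrite big_cons cintD ?IH//; exact: ccont_sum.
Qed.

Lemma Rintegral_bound a b f M : a <= b -> continuous f ->
  (forall t, `|f t| <= M) -> `|Rintegral leb `[a, b] f| <= M * (b - a).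
Proof.
move=> ab cf fM.
have le1 := @le_normr_Rintegral _ _ _ leb `[a, b] f (measurable_itv _)
  (continuous_segment_integrable _ _ cf).
apply: (le_trans le1).
have -> : M * (b - a) = Rintegral leb `[a, b] (fun=> M).
  rewrite Rintegral_cst//= lebesgue_measure_itv/= lte_fin.
  by case: ltgtP ab => //= -> _; rewrite subrr.
apply: le_Rintegral => //.
- apply: (@continuous_segment_integrable (fun t => `|f t|)) => t.
  by apply: (@continuous_comp _ _ _ f); [exact: cf|exact: norm_continuous].
- by apply: (@continuous_segment_integrable (fun=> M)) => t; exact: cvg_cst.
Qed.

Lemma cint_bound a b g M : a <= b -> ccont g ->
  (forall t, normc (g t) <= M) -> normc (cint a b g) <= 2 * (M * (b - a)).
Proof.
move=> ab [g1 g2] gM; apply: (le_trans (normc_le_ReIm _)); rewrite mulr_natl mulr2n.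
apply: lerD; apply: Rintegral_bound => // t; apply: le_trans (gM t).
  exact: normc_Re.
exact: normc_Im.
Qed.

Lemma cint_oppr a g : 0 <= a -> ccont g ->
  cint (- a) a (fun t => g (- t)) = cint (- a) a g.
Proof.
move=> a0 [g1 g2]; apply: complex_eq => /=.
  exact: (@Rintegral_oppr (fun t => Re (g t))).
exact: (@Rintegral_oppr (fun t => Im (g t))).
Qed.

End SegmentIntegrals.

Notation cint a b g := (cintegral (@lebesgue_measure _) `[a, b] g).

(** * Moments of the circle *)
Section CircleMoments.
Context {R : realType}.

Lemma le_Npi_pi : - pi <= pi :> R.
Proof. by rewrite (@le_trans _ _ 0) ?oppr_le0 ?pi_ge0. Qed.

Lemma cint_circX (k : nat) :
  cint (- pi) pi (fun t : R => circ t ^+ k.+1) = 0.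
Proof.
have k0 : k.+1%:R != 0 :> R by rewrite pnatr_eq0.
have cM : continuous (fun t : R => k.+1%:R * t).
  by apply: contM => t; [exact: cvg_cst|exact: cvg_id].
have pp : - pi < pi :> R by rewrite gtrN ?pi_gt0.
under eq_cint do rewrite circX circE.
apply: complex_eq => /=.
- have D (x : R) : is_derive x (1 : R)
      (fun t => k.+1%:R^-1 * sin (k.+1%:R * t)) (cos (k.+1%:R * x)).
    apply: is_derive_eq.
    by rewrite /GRing.scale /= mulr1 mulrCA mulVf ?mulr1.
  rewrite (Rintegral_FTC pp _ D); last first.
    by move=> t; apply: (@continuous_comp _ _ _ _ cos);
      [exact: cM|exact: continuous_cos].
  have s0 n : sin (n%:R * pi) = 0 :> R.
    elim: n => [|n IH]; first by rewrite mul0r sin0.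
    by rewrite -natr1 mulrDl mul1r sinDpi IH oppr0.
  by rewrite mulrN sinN s0 oppr0 mulr0 subr0.
- have D (x : R) : is_derive x (1 : R)
      (fun t => - (k.+1%:R^-1 * cos (k.+1%:R * t))) (sin (k.+1%:R * x)).
    apply: is_derive_eq.
    by rewrite /GRing.scale /= mulr1 mulrCA mulVf ?mulr1// opprK.
  rewrite (Rintegral_FTC pp _ D) ?mulrN ?cosN ?subrr// => t.
  by apply: (@continuous_comp _ _ _ _ sin);
    [exact: cM|exact: continuous_sin].
Qed.

Lemma cint_circ_poly (p : {poly R[i]}) :
  cint (- pi) pi (fun t : R => p.[circ t]) = (2 * pi)%:C * p.[0].
Proof.
elim/poly_ind: p => [|p c _].
  by under eq_cint do rewrite horner0; rewrite horner0 cint_cst ?le_Npi_pi ?mulr0.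
under eq_cint do rewrite hornerMXaddC.
rewrite hornerMXaddC mulr0 add0r cintD; last 2 first.
- by apply: ccontM; [exact: ccont_poly ccont_circ|exact: ccont_circ].
- exact: ccont_cst.
rewrite cint_cst ?le_Npi_pi//; set I := cint _ _ _.
suff -> : I = 0 by rewrite add0r; congr (_%:C * _); ring.
rewrite /I; under eq_cint do rewrite horner_coef big_distrl /=.
rewrite cint_sum ?le_Npi_pi//; last first.
  move=> i; apply: ccontM; last exact: ccont_circ.
  by apply: ccontM; [exact: ccont_cst|exact: ccontX ccont_circ].
rewrite big1// => i _; under eq_cint do rewrite -mulrA -exprSr.
by rewrite cintZ ?cint_circX ?mulr0//; exact: ccontX ccont_circ.
Qed.

End CircleMoments.

(** * The disc algebra *)
Section DiscAlgebra.
Context {R : realType}.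
Implicit Types (f g : R[i] -> R[i]) (u w a : R[i]).

(** The disc algebra, described by uniform approximation by polynomials on the
    closed disc: this is the form in which analyticity enters every integral
    below. *)
Definition disc_alg f := forall eps : R, 0 < eps ->
  exists p : {poly R[i]}, forall u, normc u <= 1 -> normc (f u - p.[u]) <= eps.

Lemma normc_small0 (K : R) (z : R[i]) :
  (forall eps, 0 < eps -> normc z <= K * eps) -> z = 0.
Proof.
move=> zK; apply: eq0_normc; apply/eqP; rewrite eq_le normc_ge0 andbT.
apply/ler_addgt0Pl => e e0; rewrite addr0.
have K1 : 0 < `|K| + 1 by rewrite ltr_pwDr.
apply: (le_trans (zK (e / (`|K| + 1)) (divr_gt0 e0 K1))).
rewrite mulrA ler_pdivrMr// mulrC ler_pM2l//.
by rewrite (le_trans (ler_norm K))// lerDl.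
Qed.

Lemma poly_disc_bounded (p : {poly R[i]}) :
  exists2 M : R, 0 <= M & forall u, normc u <= 1 -> normc p.[u] <= M.
Proof.
elim/poly_ind: p => [|p c [M M0 IH]].
  by exists 0 => // u _; rewrite horner0 normc0.
exists (M + normc c) => [|u u1]; first by rewrite addr_ge0 ?normc_ge0.
rewrite hornerMXaddC (le_trans (le_normcD _ _))// lerD2r normcM.
by rewrite -[M]mulr1 ler_pM ?normc_ge0 ?IH.
Qed.

Lemma disc_bounded f : disc_alg f ->
  exists2 M : R, 0 <= M & forall u, normc u <= 1 -> normc (f u) <= M.
Proof.
move=> /(_ 1 ltr01)[p fp]; have [M M0 pM] := poly_disc_bounded p.
exists (1 + M) => [|u u1]; first by rewrite addr_ge0.
rewrite -(subrK p.[u] (f u)) (le_trans (le_normcD _ _))//.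
by rewrite lerD ?fp ?pM.
Qed.

Lemma disc_poly (p : {poly R[i]}) : disc_alg (horner p).
Proof. by move=> e e0; exists p => u _; rewrite subrr normc0 ltW. Qed.

Lemma disc_ext f g : f =1 g -> disc_alg f -> disc_alg g.
Proof. by move=> /funext ->. Qed.

Lemma discD f g : disc_alg f -> disc_alg g -> disc_alg (fun u => f u + g u).
Proof.
move=> df dg e e0; have e2 : 0 < e / 2 by rewrite divr_gt0.
have [p fp] := df _ e2; have [q gq] := dg _ e2.
exists (p + q) => u u1; rewrite hornerD.
rewrite (_ : _ - _ = (f u - p.[u]) + (g u - q.[u])); last by ring.
rewrite (le_trans (le_normcD _ _))// (le_trans (lerD (fp _ u1) (gq _ u1)))//.
by rewrite -splitr.
Qed.

Lemma discM f g : disc_alg f -> disc_alg g -> disc_alg (fun u => f u * g u).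
Proof.
move=> df dg e e0.
have [M M0 fM] := disc_bounded df; have M1 : 0 < M + 1 by rewrite ltr_pwDr.
have [q gq] := dg (e / 2 / (M + 1)) ltac:(by rewrite !divr_gt0).
have [N N0 qN] := poly_disc_bounded q; have N1 : 0 < N + 1 by rewrite ltr_pwDr.
have [p fp] := df (e / 2 / (N + 1)) ltac:(by rewrite !divr_gt0).
exists (p * q) => u u1; rewrite hornerM.
rewrite (_ : _ - _ = f u * (g u - q.[u]) + (f u - p.[u]) * q.[u]); last by ring.
rewrite (le_trans (le_normcD _ _))// [leRHS]splitr !normcM lerD//.
  rewrite (le_trans (ler_pM (normc_ge0 _) (normc_ge0 _) (fM _ u1) (gq _ u1)))//.
  rewrite mulrA ler_pdivrMr// mulrC ler_pM2l ?divr_gt0// lerDl//.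
rewrite (le_trans (ler_pM (normc_ge0 _) (normc_ge0 _) (fp _ u1) (qN _ u1)))//.
by rewrite mulrAC ler_pdivrMr// ler_pM2l ?divr_gt0// lerDl.
Qed.

Lemma disc_cst (c : R[i]) : disc_alg (fun=> c).
Proof. by apply: disc_ext (disc_poly c%:P) => u; rewrite hornerC. Qed.

Lemma normc_one_sub_ge z : 1 - normc z <= normc (1 - z : R[i]).
Proof.
rewrite lerBlDr -[leLHS](@normc1 R) -{1}(subrK z (1 : R[i])).
exact: le_normcD.
Qed.

Lemma geometric_small (q K : R) : 0 <= q < 1 -> 0 <= K ->
  forall eps, 0 < eps -> exists N, K * q ^+ N <= eps.
Proof.
move=> /andP[q0 q1] K0 e e0; have K1 : 0 < K + 1 by rewrite ltr_pwDr.
have /cvgrPdist_lt := @cvg_expr R q ltac:(by rewrite ger0_norm).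
move=> /(_ (e / (K + 1)) (divr_gt0 e0 K1)) [N _ /(_ N (leqnn N))] /=.
rewrite sub0r normrN ger0_norm ?exprn_ge0// => h.
exists N; apply: (@le_trans _ _ ((K + 1) * q ^+ N)).
  by rewrite ler_wpM2r ?exprn_ge0// lerDl.
by rewrite mulrC -ler_pdivlMr// ltW.
Qed.

(** The approximants are the partial sums of the geometric series. *)
Lemma disc_geom a : normc a < 1 -> disc_alg (fun u => (1 - a * u)^-1).
Proof.
move=> a1 e e0.
have a01 : 0 <= normc a < 1 by rewrite normc_ge0.
have d0 : 0 < 1 - normc a by rewrite subr_gt0.
have [N hN] := @geometric_small (normc a) (1 - normc a)^-1 a01
  ltac:(by rewrite invr_ge0 ltW) e e0.
exists (\sum_(k < N) (a ^+ k) *: 'X^k) => u u1.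
have au : normc (a * u) <= normc a by rewrite normcM ler_piMr ?normc_ge0.
have nz : 1 - a * u != 0 by apply/one_sub_neq0/(le_lt_trans au).
have -> : (1 - a * u)^-1 - (\sum_(k < N) (a ^+ k) *: 'X^k).[u]
    = (a * u) ^+ N / (1 - a * u).
  apply: (mulIf nz); rewrite mulrBl mulVf// divfK//.
  rewrite horner_sum; under eq_bigr do rewrite hornerZ hornerXn -exprMn.
  by rewrite mulrC -(opprB (a * u)) mulNr -subrX1 opprK subrKC.
rewrite normcM normcX normcV (le_trans _ hN)// mulrC.
rewrite ler_pM ?invr_ge0 ?normc_ge0 ?exprn_ge0 ?normc_ge0//.
  rewrite lef_pV2 ?posrE ?normc_gt0//.
  by rewrite (le_trans _ (normc_one_sub_ge _))// lerD2l lerN2.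
by rewrite lerXn2r ?nnegrE ?normc_ge0.
Qed.

End DiscAlgebra.

(** * The mean value property and Cauchy's formula *)
Section MeanValue.
Context {R : realType}.
Implicit Types (f g : R[i] -> R[i]) (u w a : R[i]).

Lemma normc_circ_le1 (t : R) : normc (circ t) <= 1.
Proof. by rewrite normc_circ. Qed.

(** The cost of replacing a function of the disc algebra by a polynomial
    under the integral sign. *)
Lemma cint_near f p (K : R) (k : R -> R[i]) (e : R) :
  ccont (fun t => f (circ t)) -> ccont k -> (forall t, normc (k t) <= K) ->
  (forall u, normc u <= 1 -> normc (f u - p.[u]) <= e) ->
  normc (cint (- pi) pi (fun t => f (circ t) * k t) -
         cint (- pi) pi (fun t => p.[circ t] * k t)) <= 2 * (e * K * (2 * pi)).
Proof.
move=> cf ck kK fp.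
have cp : ccont (fun t : R => p.[circ t]) := ccont_poly p ccont_circ.
rewrite -cintB; [|exact: ccontM..].
rewrite (_ : 2 * pi = pi - - pi); last by rewrite opprK mulr_natl mulr2n.
apply: cint_bound; first exact: le_Npi_pi.
  by apply: ccontB; exact: ccontM.
move=> t; rewrite -mulrBl normcM ler_pM ?normc_ge0//.
by rewrite fp ?normc_circ_le1.
Qed.

(** Both sides are continuous for uniform convergence on the disc, and they
    agree on polynomials, whose nonconstant monomials have mean zero. *)
Lemma disc_mean_value f : disc_alg f -> ccont (fun t => f (circ t)) ->
  cint (- pi) pi (fun t : R => f (circ t)) = (2 * pi)%:C * f 0.
Proof.
move=> df cf; apply/eqP; rewrite -subr_eq0; apply/eqP.
apply: (@normc_small0 _ (2 * (1 * (2 * pi)) + 2 * pi)) => e e0.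
have [p fp] := df e e0.
have H := @cint_near f p 1 (fun=> 1) e cf (ccont_cst _)
  (fun=> ltac:(by rewrite normc1)) fp.
rewrite !(eq_cint _ _ (fun t => mulr1 _)) in H.
rewrite -(subrK (cint (- pi) pi (fun t => p.[circ t])) (cint _ _ _)) -addrA.
rewrite (le_trans (le_normcD _ _))// [leRHS]mulrDl lerD//.
  by apply: (le_trans H); rewrite le_eqVlt; apply/orP; left; apply/eqP; ring.
rewrite cint_circ_poly -mulrBr normcM normcR ger0_norm ?mulr_ge0 ?pi_ge0//.
rewrite ler_pM2l ?mulr_gt0 ?pi_gt0//.
by rewrite -normcN opprB fp ?normc0.
Qed.

Lemma disc_mean_value_conj f : disc_alg f -> ccont (fun t => f (circ t)) ->
  cint (- pi) pi (fun t : R => f (circ (- t))) = (2 * pi)%:C * f 0.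
Proof.
move=> df cf; rewrite -disc_mean_value//.
by rewrite (@cint_oppr _ pi (fun t => f (circ t))) ?pi_ge0.
Qed.

Lemma one_sub_circ_neq0 w (t : R) : normc w < 1 -> 1 - w * circ t != 0.
Proof. by move=> w1; rewrite one_sub_neq0// normcM normc_circ mulr1. Qed.

Lemma ccont_cauchy_kernel w : normc w < 1 ->
  ccont (fun t : R => (1 - w * circ t)^-1).
Proof.
move=> w1; apply: ccontV => [t|]; first exact: one_sub_circ_neq0.
apply: ccontB; first exact: ccont_cst.
by apply: ccontM; [exact: ccont_cst|exact: ccont_circ].
Qed.

Lemma ccont_cauchy_kernelN w : normc w < 1 ->
  ccont (fun t : R => (1 - w * circ (- t))^-1).
Proof.
move=> w1; apply: (@ccont_comp _ (fun t : R => (1 - w * circ t)^-1)).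
  exact: opp_continuous.
exact: ccont_cauchy_kernel.
Qed.

(** Since [u / (1 - w / u) = u + w / (1 - w / u)] on the circle, one power of
    [u] can be traded for one factor [w]; the remaining terms have mean
    zero. *)
Lemma cint_cauchy_poly w (p : {poly R[i]}) : normc w < 1 ->
  cint (- pi) pi (fun t : R => p.[circ t] * (1 - w * circ (- t))^-1)
  = (2 * pi)%:C * p.[w].
Proof.
move=> w1.
have ck := ccont_cauchy_kernelN w1.
have cp q : ccont (fun t : R => q.[circ t]) := ccont_poly q ccont_circ.
elim/poly_ind: p => [|p c IH].
  under eq_cint do rewrite horner0 mul0r.
  by rewrite horner0 cint_cst ?le_Npi_pi ?mulr0.
have E (t : R) : (p * 'X + c%:P).[circ t] * (1 - w * circ (- t))^-1 =
    (p * 'X).[circ t] + (w * (p.[circ t] * (1 - w * circ (- t))^-1) +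
     c * (1 - w * circ (- t))^-1).
  rewrite !hornerD hornerC hornerM hornerX -circV.
  have := one_sub_circ_neq0 (- t) w1; rewrite -circV.
  move: (circ_neq0 t); move: (circ t) p.[circ t] => u v u0 n0.
  have n0' : u - w != 0.
    by rewrite -(mulVKf u0 (u - w)) mulf_neq0// mulrBr mulVf// mulrC.
  by field; apply/andP.
under eq_cint do rewrite E.
rewrite cintD; last 2 first.
- exact: cp.
- apply: ccontD; apply: ccontM => //; try exact: ccont_cst.
  exact: ccontM.
rewrite cint_circ_poly hornerM hornerX mulr0 mulr0 add0r cintD; last 2 first.
- by apply: ccontM; [exact: ccont_cst|exact: ccontM].
- by apply: ccontM; [exact: ccont_cst|].
rewrite !cintZ//; last exact: ccontM.
rewrite IH (@disc_mean_value_conj (fun u => (1 - w * u)^-1)); last 2 first.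
- exact: disc_geom.
- exact: ccont_cauchy_kernel.
by rewrite mulr0 subr0 invr1 hornerMXaddC; ring.
Qed.

(** Cauchy's integral formula, by approximation from the polynomial case. *)
Lemma disc_cauchy f w : disc_alg f -> ccont (fun t => f (circ t)) ->
  normc w < 1 ->
  cint (- pi) pi (fun t : R => f (circ t) * (1 - w * circ (- t))^-1)
  = (2 * pi)%:C * f w.
Proof.
move=> df cf w1; apply/eqP; rewrite -subr_eq0; apply/eqP.
have ck := ccont_cauchy_kernelN w1.
pose K := (1 - normc w)^-1.
have kK (t : R) : normc (1 - w * circ (- t))^-1 <= K.
  rewrite normcV lef_pV2 ?posrE ?normc_gt0 ?one_sub_circ_neq0 ?subr_gt0//.
  by rewrite (le_trans _ (normc_one_sub_ge _))// normcM normc_circ mulr1.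
apply: (@normc_small0 _ (2 * (K * (2 * pi)) + 2 * pi)) => e e0.
have [p fp] := df e e0.
have H := @cint_near f p K _ e cf ck kK fp.
rewrite -(subrK (cint (- pi) pi
  (fun t => p.[circ t] * (1 - w * circ (- t))^-1)) (cint _ _ _)) -addrA.
rewrite (le_trans (le_normcD _ _))// [leRHS]mulrDl lerD//.
  by apply: (le_trans H); rewrite le_eqVlt; apply/orP; left; apply/eqP; ring.
rewrite cint_cauchy_poly// -mulrBr normcM normcR ger0_norm ?mulr_ge0 ?pi_ge0//.
rewrite ler_pM2l ?mulr_gt0 ?pi_gt0//.
by rewrite -normcN opprB fp ?ltW.
Qed.

End MeanValue.

(** * The logarithm of 1 - z *)
Section ComplexLog.
Context {R : realType}.
Implicit Types (z w a : R[i]) (x y s : R).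

Lemma cRe_sum (I : Type) (r : seq I) (P : pred I) (F : I -> R[i]) :
  Re (\sum_(i <- r | P i) F i) = \sum_(i <- r | P i) Re (F i).
Proof. exact: (big_morph _ (@cReD R)). Qed.

Lemma cIm_sum (I : Type) (r : seq I) (P : pred I) (F : I -> R[i]) :
  Im (\sum_(i <- r | P i) F i) = \sum_(i <- r | P i) Im (F i).
Proof. exact: (big_morph _ (@cImD R)). Qed.

(** The principal branch of [log (1 - z)] on the unit disc: there [1 - z] has
    positive real part, so its argument is an arctangent. *)
Definition clog1m z : R[i] :=
  (ln ((1 - Re z) ^+ 2 + Im z ^+ 2) / 2) +i* (- atan (Im z / (1 - Re z))).

Lemma Re_lt1 z : normc z < 1 -> 0 < 1 - Re z.
Proof.
by move=> z1; rewrite subr_gt0 (le_lt_trans _ z1)// (le_trans (ler_norm _))// normc_Re.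
Qed.

Lemma clog1m_arg_gt0 z : normc z < 1 -> 0 < (1 - Re z) ^+ 2 + Im z ^+ 2.
Proof.
by move=> z1; rewrite ltr_pwDl ?sqr_ge0// exprn_gt0// Re_lt1.
Qed.

Lemma normc_one_sub_sqr z : normc (1 - z) ^+ 2 = (1 - Re z) ^+ 2 + Im z ^+ 2.
Proof. by rewrite normc_sqr cReD cImD cReN cImN /= add0r sqrrN. Qed.

Lemma Re_clog1m z : normc z < 1 -> Re (clog1m z) = ln (normc (1 - z)).
Proof.
move=> z1; rewrite /clog1m /= -normc_one_sub_sqr.
rewrite lnXn ?normc_gt0 ?one_sub_neq0//.
by rewrite mulr2n; field.
Qed.

Lemma sin_atan x : sin (atan x) = x / Num.sqrt (1 + x ^+ 2).
Proof.
have c0 : 0 < cos (atan x) by rewrite cos_gt0_pihalf// atan_gtNpi2 atan_ltpi2.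
by rewrite -cos_atan -{2}(atanK x) /tan divfK// gt_eqF.
Qed.

Lemma cexp_clog1m z : normc z < 1 -> cexp (clog1m z) = 1 - z.
Proof.
move=> z1; have x1 := Re_lt1 z1.
have rE : normc (1 - z) = (1 - Re z) * Num.sqrt (1 + (Im z / (1 - Re z)) ^+ 2).
  apply/eqP; rewrite -(@eqrXn2 _ 2) ?normc_ge0 ?mulr_ge0 ?sqrtr_ge0 ?(ltW x1)//.
  rewrite normc_one_sub_sqr exprMn sqr_sqrtr ?addr_ge0 ?sqr_ge0//.
  by rewrite expr_div_n mulrDr mulr1 mulrCA divff ?mulr1// expf_neq0// gt_eqF.
have s0 : Num.sqrt (1 + (Im z / (1 - Re z)) ^+ 2) != 0.
  by rewrite gt_eqF// sqrtr_gt0 ltr_pwDl ?sqr_ge0.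
rewrite /cexp Re_clog1m// lnK ?posrE ?normc_gt0 ?one_sub_neq0//.
rewrite {1 2}rE /= cosN sinN cos_atan sin_atan.
apply: complex_eq; rewrite ?cReD ?cImD ?cReN ?cImN /=; first by rewrite mulfK.
by field; rewrite s0 gt_eqF.
Qed.

Lemma clog1m_conj z : clog1m z^* = (clog1m z)^*.
Proof.
by case: z => x y; rewrite /clog1m /= sqrrN mulNr atanN opprK.
Qed.

Lemma clog1m0 : clog1m 0 = 0.
Proof.
by rewrite /clog1m /= subr0 expr1n expr0n addr0 ln1 !mul0r atan0 oppr0.
Qed.

(** On the circle the logarithm of the modulus is thus half the sum of an
    analytic function of [u] and an analytic function of [u^-1]. *)
Lemma ln_normc_one_sub z : normc z < 1 ->
  (ln (normc (1 - z)))%:C = (clog1m z + clog1m z^*) / 2.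
Proof.
move=> z1; rewrite -Re_clog1m// clog1m_conj.
by rewrite (_ : _ + _ = 2 * (Re (clog1m z))%:C) ?addcJ// mulrC mulKf// pnatr_eq0.
Qed.

Lemma mean_value_bound (f df : R -> R) (M : R) :
  (forall s, 0 <= s <= 1 -> is_derive s (1 : R) f (df s)) ->
  (forall s, 0 <= s <= 1 -> `|df s| <= M) -> `|f 1 - f 0| <= M.
Proof.
move=> dfE dfM.
have [||c] := @MVT_segment R f df 0 1 ler01.
- move=> s; rewrite in_itv/= => /andP[s0 s1]; apply: dfE.
  by rewrite !ltW.
- apply: derivable_within_continuous => s; rewrite in_itv/= => s01.
  by case: (dfE s s01).
- by rewrite in_itv/= => c01 ->; rewrite subr0 mulr1 dfM.
Qed.

(** Along the ray from [0] to [z] the remainder of the Taylor polynomial has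
    derivative [- z (s z)^N / (1 - s z)], which the mean value inequality
    controls coordinatewise. *)
Lemma clog1m_taylor z (q : R) (N : nat) : normc z <= q -> q < 1 ->
  normc (clog1m z + \sum_(k < N) z ^+ k.+1 / k.+1%:R)
  <= 2 * (q ^+ N.+1 / (1 - q)).
Proof.
move=> zq q1; have q0 : 0 <= q := le_trans (normc_ge0 _) zq.
pose D s : R[i] := - z / (1 - s%:C * z) + \sum_(k < N) z ^+ k.+1 * s%:C ^+ k.
have sz s : 0 <= s <= 1 -> normc (s%:C * z) <= q.
  move=> /andP[s0 s1]; rewrite normcM normcR ger0_norm//.
  by rewrite (le_trans _ zq)// ler_piMl ?normc_ge0.
have sz1 s : 0 <= s <= 1 -> normc (s%:C * z) < 1.
  by move=> s01; apply: le_lt_trans q1; exact: sz.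
have DE s : 0 <= s <= 1 -> D s = - (z * (s%:C * z) ^+ N / (1 - s%:C * z)).
  move=> s01; have nz := one_sub_neq0 (sz1 s s01).
  rewrite /D; apply: (mulIf nz); rewrite mulrDl divfK// mulNr divfK//.
  have -> : \sum_(k < N) z ^+ k.+1 * s%:C ^+ k
      = z * \sum_(k < N) (s%:C * z) ^+ k.
    rewrite big_distrr; apply: eq_bigr => k _ /=.
    by rewrite exprS exprMn; ring.
  rewrite -mulrA [_ * (1 - _)]mulrC -(opprB _ 1) mulNr -subrX1; ring.
have DM s : 0 <= s <= 1 -> normc (D s) <= q ^+ N.+1 / (1 - q).
  move=> s01; rewrite DE// normcN !normcM normcV normcX exprS.
  have nz := one_sub_neq0 (sz1 s s01).
  rewrite ler_pM ?mulr_ge0 ?invr_ge0 ?exprn_ge0 ?normc_ge0//.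
    rewrite ler_pM ?exprn_ge0 ?normc_ge0// lerXn2r ?nnegrE ?normc_ge0// sz//.
  rewrite lef_pV2 ?posrE ?normc_gt0 ?subr_gt0//.
  by rewrite (le_trans _ (normc_one_sub_ge _))// lerD2l lerN2 sz.
pose P (T : R[i] -> R) : {poly R} := 
  \sum_(k < N) (T (z ^+ k.+1) / k.+1%:R) *: 'X^(k.+1).
have dP T s : (P T)^`().[s] = \sum_(k < N) T (z ^+ k.+1) * s ^+ k.
  rewrite /P raddf_sum horner_sum; apply: eq_bigr => k _ /=.
  rewrite derivZ derivXn hornerZ hornerMn hornerXn /= mulrnAr -mulrnAl.
  by rewrite -mulr_natr divfK// pnatr_eq0.
have P0 T : (P T).[0] = 0.
  rewrite /P horner_sum big1// => k _.
  by rewrite hornerZ hornerXn expr0n mulr0.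
have P1 T : (P T).[1] = \sum_(k < N) T (z ^+ k.+1) / k.+1%:R.
  by rewrite /P horner_sum; apply: eq_bigr => k _; rewrite hornerZ hornerXn expr1n mulr1.
have Rediv (v : R[i]) k : Re (v / k.+1%:R) = Re v / k.+1%:R.
  rewrite -(rmorph_nat (real_complex R)) -fmorphV cReM /= mulr0 subr0//.
have Imdiv (v : R[i]) k : Im (v / k.+1%:R) = Im v / k.+1%:R.
  rewrite -(rmorph_nat (real_complex R)) -fmorphV cImM /= mulr0 add0r//.
have ReX (v : R[i]) s k : Re (v * s%:C ^+ k) = Re v * s ^+ k.
  by rewrite -rmorphXn cReM /= mulr0 subr0.
have ImX (v : R[i]) s k : Im (v * s%:C ^+ k) = Im v * s ^+ k.
  by rewrite -rmorphXn cImM /= mulr0 add0r.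
case: z => x y in zq D sz sz1 DE DM P dP P0 P1 *.
have pos s : 0 <= s <= 1 -> 0 < (1 - s * x) ^+ 2 + (s * y) ^+ 2.
  move=> s01; have := clog1m_arg_gt0 (sz1 s s01).
  by rewrite cReM cImM /= !mul0r subr0 addr0.
have pos1 s : 0 <= s <= 1 -> 0 < 1 - s * x.
  move=> s01; have := Re_lt1 (sz1 s s01).
  by rewrite cReM /= !mul0r subr0.
apply: (le_trans (normc_le_ReIm _)); rewrite mulr_natl mulr2n; apply: lerD.
- pose f s := ln ((1 - s * x) ^+ 2 + (s * y) ^+ 2) / 2 + (P (@Re R)).[s].
  have -> : Re (clog1m (x +i* y) + \sum_(k < N) (x +i* y) ^+ k.+1 / k.+1%:R)
      = f 1 - f 0.
    rewrite /f P0 P1 !mul0r subr0 expr1n expr0n /= !addr0 ln1 mul0r subr0.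
    rewrite !mul1r cReD cRe_sum; congr (_ + _).
    by apply: eq_bigr => k _; rewrite Rediv.
  apply: (@mean_value_bound f (fun s => Re (D s))) => s s01; last first.
    by apply: (le_trans (normc_Re _)); exact: DM.
  have l0 := pos s s01.
  pose g s := (1 - s * x) ^+ 2 + (s * y) ^+ 2.
  have dg : is_derive s (1 : R) g (2 * (s * (x ^+ 2 + y ^+ 2) - x)).
    by apply: is_derive_eq; rewrite /GRing.scale /=; ring.
  have dl := @is_derive1_comp R (@ln R) g s _ _ (is_derive1_ln l0) dg.
  have -> : f = (fun s => (@ln R \o g) s * 2^-1 + (P (@Re R)).[s]) by [].
  apply: is_derive_eq.
  rewrite dP /D cReD cRe_sum; congr (_ + _); last first.
    by apply: eq_bigr => k _; rewrite ReX.
  rewrite cReM cReV cImV cReD cImD !cReN !cImN cReM cImM /= !mul0r.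
  rewrite subr0 addr0 /GRing.scale /= /g in l0 *.
  by field; rewrite sqrrN gt_eqF.
- pose f s := - atan (s * y / (1 - s * x)) + (P (@Im R)).[s].
  have -> : Im (clog1m (x +i* y) + \sum_(k < N) (x +i* y) ^+ k.+1 / k.+1%:R)
      = f 1 - f 0.
    rewrite /f P0 P1 !mul0r atan0 oppr0 addr0 subr0 !mul1r cImD cIm_sum.
    by congr (_ + _); apply: eq_bigr => k _; rewrite Imdiv.
  apply: (@mean_value_bound f (fun s => Im (D s))) => s s01; last first.
    by apply: (le_trans (normc_Im _)); exact: DM.
  have l0 := pos s s01; have l1 := pos1 s s01.
  have l1' : 1 - s * x != 0 by rewrite gt_eqF.
  pose g s := s * y / (1 - s * x).
  have dv : is_derive s (1 : R) (fun s => (1 - s * x)^-1)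
      (- (1 - s * x) ^- 2 * (- x)).
    have dh : is_derive s (1 : R) (fun s => 1 - s * x) (- x).
      by apply: is_derive_eq; rewrite /GRing.scale /=; ring.
    by apply: (@is_derive_eq _ _ _ _ _ _ _ _ (is_deriveV _ _)).
  have dg : is_derive s (1 : R) g (y / (1 - s * x) ^+ 2).
    rewrite /g; apply: is_derive_eq; rewrite /GRing.scale /=.
    by field.
  have dl := @is_derive1_comp R (@atan R) g s _ _ (is_derive1_atan (g s)) dg.
  have -> : f = (fun s => - (@atan R \o g) s + (P (@Im R)).[s]) by [].
  apply: is_derive_eq.
  rewrite dP /D cImD cIm_sum; congr (_ + _); last first.
    by apply: eq_bigr => k _; rewrite ImX.
  rewrite cImM cReV cImV cReD cImD !cReN !cImN cReM cImM /= !mul0r.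
  rewrite subr0 addr0 /g.
  by field; rewrite sqrrN l1' gt_eqF.
Qed.

(** The approximants are the Taylor polynomials. *)
Lemma disc_clog1m a : normc a < 1 -> disc_alg (fun u => clog1m (a * u)).
Proof.
move=> a1 e e0; set q := normc a; have q0 : 0 <= q := normc_ge0 a.
have [N hN] := @geometric_small R q (2 * (q / (1 - q))) ltac:(by rewrite q0)
  ltac:(by rewrite mulr_ge0// divr_ge0// subr_ge0 ltW) e e0.
exists (- \sum_(k < N) (a ^+ k.+1 / k.+1%:R) *: 'X^(k.+1)) => u u1.
have au : normc (a * u) <= q by rewrite normcM ler_piMr.
rewrite hornerN opprK horner_sum.
under eq_bigr do rewrite hornerZ hornerXn mulrAC -exprMn.
apply: (le_trans (clog1m_taylor N au a1)); apply: le_trans hN.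
by rewrite exprS le_eqVlt; apply/orP; left; apply/eqP; ring.
Qed.

Lemma ccont_clog1m a : normc a < 1 -> ccont (fun t : R => clog1m (a * circ t)).
Proof.
move=> a1.
have [cre cim] : ccont (fun t : R => a * circ t).
  by apply: ccontM; [exact: ccont_cst|exact: ccont_circ].
have au t : normc (a * circ t) < 1 by rewrite normcM normc_circ mulr1.
have c1 : continuous (fun t : R => 1 - Re (a * circ t)).
  by apply: contB => // t; exact: cvg_cst.
split=> /= t.
- apply: cvgM; last exact: cvg_cst.
  apply: (@continuous_comp _ _ _ (fun t : R =>
     (1 - Re (a * circ t)) ^+ 2 + Im (a * circ t) ^+ 2) (@ln R)).
    apply: (@contD _ _ (fun t => (1 - Re (a * circ t)) ^+ 2)
      (fun t => Im (a * circ t) ^+ 2));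
    by under eq_fun do rewrite expr2; exact: contM.
  by apply: continuous_ln; exact: clog1m_arg_gt0.
- apply: cvgN; apply: (@continuous_comp _ _ _ (fun t : R =>
     Im (a * circ t) / (1 - Re (a * circ t))) (@atan R)).
    apply: contM => //; apply: contV => // s.
    by rewrite gt_eqF// Re_lt1.
  exact: continuous_atan.
Qed.

End ComplexLog.

(** * The Joukowski map *)
Section Joukowski.
Context {R : realType}.
Implicit Types (z u a b : R[i]).

Lemma joukowskiV u : joukowski u^-1 = joukowski u.
Proof. by rewrite /joukowski invrK addrC. Qed.

Lemma joukowski_conj u : joukowski u^* = (joukowski u)^*.
Proof.
by rewrite /joukowski rmorphM rmorphD !fmorphV rmorph_nat.
Qed.

Lemma phi_neq0_joukowski z : phi z != 0 /\ joukowski (phi z) = z.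
Proof.
rewrite /phi; set s := sqrtC _; have ss : s ^+ 2 = z ^+ 2 - 1 by rewrite sqrtCK.
have pq : (z + s) * (z - s) = 1.
  by rewrite mulrC -subr_sqr ss opprB addrCA subrr addr0.
have zs0 : z + s != 0 by apply: contra_eq_neq pq => ->; rewrite mul0r eq_sym oner_eq0.
have zs0' : z - s != 0 by apply: contra_eq_neq pq => ->; rewrite mulr0 eq_sym oner_eq0.
have V : (z + s)^-1 = z - s by apply: (mulfI zs0); rewrite divff.
have V' : (z - s)^-1 = z + s by rewrite -V invrK.
by case: ifP => _; split=> //; rewrite /joukowski ?V ?V'; field.
Qed.

(** If [phi z] had modulus one, its inverse would be its conjugate, and [z]
    the real part of a number of modulus one. *)
Lemma phi_gt1 z : ~ interval_pm1 z -> 1 < normc (phi z).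
Proof.
move=> zI; rewrite ltNge; apply/negP => p1; apply: zI.
have [p0 Jp] := phi_neq0_joukowski z.
have {}p1 : normc (phi z) = 1.
  apply/eqP; rewrite eq_le p1 /=; move: p1; rewrite /phi norm_normc ltcR.
  case: ltP => [/ltW //|q1 _]; set s := sqrtC _.
  have ss : s ^+ 2 = z ^+ 2 - 1 by rewrite sqrtCK.
  have : normc (z + s) * normc (z - s) = 1.
    by rewrite -normcM mulrC -subr_sqr ss opprB addrCA subrr addr0 normc1.
  move=> pq; rewrite -[leLHS]pq ler_piMl ?normc_ge0//.
have pV : (phi z)^-1 = (phi z)^*.
  apply: (mulfI p0); rewrite divff//; case: (phi z) p1 => x y /= r1.
  apply: complex_eq => /=; last by rewrite mulrN; ring.
  rewrite mulrN opprK -!expr2.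
  by rewrite -[RHS]sqr_sqrtr ?addr_ge0 ?sqr_ge0// r1 expr1n.
exists (Re (phi z)).
  by rewrite /= in_itv/= -ler_norml -p1 normc_Re.
rewrite -[RHS]Jp /joukowski pV addcJ mulrC mulrA mulVf ?mul1r// pnatr_eq0.
Qed.

(** In [u] the difference has the zeros [a] and [a^-1] and a simple pole at
    the origin. *)
Lemma joukowskiB u a : u != 0 -> a != 0 ->
  joukowski u - joukowski a = - (2 * a)^-1 * ((1 - a * u) * (1 - a * u^-1)).
Proof. by move=> u0 a0; rewrite /joukowski; field; exact/andP. Qed.

Lemma joukowski_inj_disc a b : a != 0 -> b != 0 -> normc a < 1 -> normc b < 1 ->
  joukowski a = joukowski b -> a = b.
Proof.
move=> a0 b0 a1 b1 /eqP; rewrite -subr_eq0 joukowskiB//.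
rewrite mulf_eq0 oppr_eq0 invr_eq0 mulf_eq0 pnatr_eq0 (negPf b0) /=.
have ba : 1 - b * a != 0.
  by rewrite one_sub_neq0// normcM mulr_ilt1 ?normc_ge0.
rewrite mulf_eq0 (negPf ba) /= subr_eq0 => /eqP h.
by rewrite -[a](mul1r a) h divfK.
Qed.

(** The reciprocal of [phi] is the branch of the inverse of the Joukowski map
    with values in the unit disc. *)
Definition inner (z : R[i]) : R[i] := (phi z)^-1.

Lemma inner_neq0 z : inner z != 0.
Proof. by rewrite invr_eq0; case: (phi_neq0_joukowski z). Qed.

Lemma joukowski_inner z : joukowski (inner z) = z.
Proof. by rewrite joukowskiV; case: (phi_neq0_joukowski z). Qed.

Lemma inner_lt1 z : ~ interval_pm1 z -> normc (inner z) < 1.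
Proof.
by move=> /phi_gt1 z1; rewrite normcV invf_lt1// (lt_trans ltr01).
Qed.

Lemma interval_pm1_conj z : ~ interval_pm1 z -> ~ interval_pm1 z^*.
Proof.
by move=> zI [x x1 xz]; apply: zI; exists x => //; rewrite -[z]conjcK -xz conjc_real.
Qed.

Lemma inner_conj z : ~ interval_pm1 z -> inner z^* = (inner z)^*.
Proof.
move=> zI; apply: joukowski_inj_disc; rewrite ?conjc_eq0 ?inner_neq0//.
- exact/inner_lt1/interval_pm1_conj.
- by rewrite normc_conj inner_lt1.
- by rewrite joukowski_conj !joukowski_inner.
Qed.

End Joukowski.

(** * The outer factor and the Szego function *)
Section SzegoFunction.
Context {R : realType}.
Variables (rho : {poly R}) (r : R) (s : seq R[i]).
Hypothesis r0 : r != 0.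
Hypothesis rhoE : map_poly (real_complex R) rho =
  r%:C *: \prod_(x <- s) ('X - x%:P).
Hypothesis rho_gt0 : forall x : R, -1 <= x <= 1 -> 0 < rho.[x].

Lemma denominator_roots_off x : x \in s -> ~ interval_pm1 x.
Proof.
move=> xs [y]; rewrite /= in_itv/= => /rho_gt0 py yx.
have : root (map_poly (real_complex R) rho) x.
  by rewrite rhoE rootZ ?root_prod_XsubC// (inj_eq (@complexI R) _ 0).
rewrite -yx /root horner_map /= (inj_eq (@complexI R) _ 0) gt_eqF//.
Qed.

Let off := denominator_roots_off.

(** The coefficients of [rho] are real. *)
Lemma denominator_roots_conj : perm_eq [seq x^* | x <- s] s.
Proof.
apply: prod_XsubC_eq.
have rc0 : r%:C != 0 :> R[i] by rewrite (inj_eq (@complexI R) _ 0).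
apply: (scalerI rc0); rewrite -rhoE.
have -> : map_poly (real_complex R) rho =
    map_poly conjc (map_poly (real_complex R) rho).
  by rewrite -map_poly_comp; apply: eq_map_poly => x /=; rewrite oppr0.
rewrite rhoE map_polyZ /= oppr0; congr (_ *: _).
rewrite rmorph_prod big_map; apply: eq_bigr => x _.
by rewrite rmorphB /= map_polyX map_polyC.
Qed.

(** The reciprocals of the zeros of the outer factor of [rho]. *)
Definition inner_roots := [seq inner x | x <- s].

Lemma inner_roots_lt1 a : a \in inner_roots -> normc a < 1.
Proof. by move=> /mapP[x xs ->]; exact/inner_lt1/off. Qed.

Lemma inner_roots_conj (F : R[i] -> R[i]) :
  \sum_(a <- inner_roots) F a^* = \sum_(a <- inner_roots) F a.
Proof.
rewrite !big_map -[RHS](perm_big _ denominator_roots_conj) /= big_map.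
by apply: eq_big_seq => x xs; rewrite inner_conj//; exact: off.
Qed.

Definition outer (w : R[i]) := \prod_(a <- inner_roots) (1 - a * w).

(** What remains of [rho] when each linear factor is written as in
    [joukowskiB]. *)
Definition outer_const : R[i] := r%:C * \prod_(a <- inner_roots) - (2 * a)^-1.

Lemma outer_const_neq0 : outer_const != 0.
Proof.
rewrite mulf_neq0 ?(inj_eq (@complexI R) _ 0)// prodf_seq_neq0.
apply/allP => a /mapP[x xs ->]; rewrite /= oppr_eq0 invr_eq0 mulf_neq0 ?pnatr_eq0//.
exact: inner_neq0.
Qed.

(** The theorem of Fejer and Riesz: each root of [rho] is the image of one
    point inside and one point outside the circle, and keeping the outside
    points gives a factor without zeros in the closed disc. *)
Lemma fejer_riesz u : u != 0 ->
  (map_poly (real_complex R) rho).[joukowski u] =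
  outer_const * (outer u * outer u^-1).
Proof.
move=> u0; rewrite rhoE hornerZ horner_prod /outer_const /outer -mulrA.
congr (_ * _); rewrite !big_map -!big_split /=.
apply: eq_bigr => x _; rewrite hornerXsubC -[x in LHS]joukowski_inner.
by rewrite joukowskiB ?inner_neq0.
Qed.

Lemma outer_neq0 w : normc w <= 1 -> outer w != 0.
Proof.
move=> w1; rewrite prodf_seq_neq0; apply/allP => a az /=.
rewrite one_sub_neq0// normcM (le_lt_trans _ (inner_roots_lt1 az))//.
by rewrite ler_piMr ?normc_ge0.
Qed.

Lemma rho_cos (t : R) :
  (rho.[cos t])%:C = outer_const * (outer (circ t) * outer (circ (- t))).
Proof.
by rewrite -circV -fejer_riesz ?circ_neq0// joukowski_circ horner_map.
Qed.

Definition log_outer (w : R[i]) := \sum_(a <- inner_roots) clog1m (a * w).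

Lemma cexp_log_outer w : normc w < 1 -> cexp (log_outer w) = outer w.
Proof.
move=> w1; rewrite /log_outer cexp_sum; apply: eq_big_seq => a az.
by rewrite cexp_clog1m// normcM mulr_ilt1 ?normc_ge0// inner_roots_lt1.
Qed.

Lemma log_outer0 : log_outer 0 = 0.
Proof. by rewrite /log_outer big1// => a _; rewrite mulr0 clog1m0. Qed.

Lemma disc_sum_seq (I : eqType) (l : seq I) (F : I -> R[i] -> R[i]) :
  (forall i, i \in l -> disc_alg (F i)) -> disc_alg (fun u => \sum_(i <- l) F i u).
Proof.
move=> dF; have : all [in l] l by apply/allP.
elim: {-1}l => [|i l' IH] /=.
  by move=> _; apply: disc_ext (disc_cst 0) => u; rewrite big_nil.
move=> /andP[il al]; apply: disc_ext (discD (dF i il) (IH al)) => u.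
by rewrite big_cons.
Qed.

Lemma disc_log_outer : disc_alg log_outer.
Proof. by apply: disc_sum_seq => a /inner_roots_lt1; exact: disc_clog1m. Qed.

Lemma ccont_log_outer : ccont (fun t : R => log_outer (circ t)).
Proof.
rewrite /log_outer; have : all [in inner_roots] inner_roots by apply/allP.
elim: {-1}inner_roots => [|a l IH] /=.
  by move=> _; under eq_fun do rewrite big_nil; exact: ccont_cst.
move=> /andP[al /IH cl]; under eq_fun do rewrite big_cons.
by apply: ccontD => //; exact/ccont_clog1m/inner_roots_lt1.
Qed.

Lemma ln_prod_seq (I : eqType) (l : seq I) (F : I -> R) :
  (forall i, i \in l -> 0 < F i) ->
  0 < \prod_(i <- l) F i /\ ln (\prod_(i <- l) F i) = \sum_(i <- l) ln (F i).
Proof.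
elim: l => [|i l IH] F0; first by rewrite !big_nil ln1.
have [p0 pE] := IH (fun j jl => F0 j ltac:(by rewrite inE jl orbT)).
have Fi := F0 i (mem_head _ _).
by rewrite !big_cons mulr_gt0// lnM ?posrE// pE.
Qed.

Lemma ln_rho_cos (t : R) : (ln rho.[cos t])%:C =
  (ln (normc outer_const))%:C + log_outer (circ t) + log_outer (circ (- t)).
Proof.
have p0 : 0 < rho.[cos t] by rewrite rho_gt0// cos_geN1 cos_le1.
have -> : rho.[cos t] = normc outer_const *
    (normc (outer (circ t)) * normc (outer (circ (- t)))).
  by rewrite -!normcM -rho_cos normcR gtr0_norm.
have C0 : 0 < normc outer_const by rewrite normc_gt0 outer_const_neq0.
have o0 x : 0 < normc (outer (circ x)).
  by rewrite normc_gt0 outer_neq0 ?normc_circ.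
have az1 x a : a \in inner_roots -> normc (a * circ x) < 1.
  by move=> /inner_roots_lt1; rewrite normcM normc_circ mulr1.
have cj x a : (a * circ x)^* = a^* * circ (- x) by rewrite rmorphM circN.
have lo x : (ln (normc (outer (circ x))))%:C =
   (log_outer (circ x) + log_outer (circ (- x))) / 2.
  have -> : normc (outer (circ x)) =
      \prod_(a <- inner_roots) normc (1 - a * circ x).
    exact: (big_morph _ (@normcM R) (@normc1 R)).
  have [|_ ->] := @ln_prod_seq _ inner_roots (fun a => normc (1 - a * circ x)).
    by move=> a az; rewrite normc_gt0 one_sub_neq0// az1.
  rewrite rmorph_sum /=.
  under eq_big_seq => a az do
    rewrite (ln_normc_one_sub (az1 x a az)) cj.
  rewrite -big_distrl big_split /=; congr ((_ + _) / _).
  by rewrite (inner_roots_conj (fun a => clog1m (a * circ (- x)))).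
by rewrite lnM ?posrE ?mulr_gt0// lnM ?posrE// !rmorphD /= !lo opprK; field.
Qed.

(** On the circle [ln rho] is a constant plus an analytic logarithm plus its
    reflection; the Schwarz kernel reproduces the analytic part and kills the
    reflected one. *)
Lemma szego_outer w : normc w < 1 ->
  szego (horner rho) w =
  cexp ((ln (normc outer_const))%:C / 2) * outer w.
Proof.
move=> w1; rewrite -cexp_log_outer// -cexpD /szego; congr cexp.
set c := (ln (normc outer_const))%:C.
pose k (t : R) := (1 - w * circ (- t))^-1.
have ck : ccont k := ccont_cauchy_kernelN w1.
have k0 t : 1 - w * circ (- t) != 0 := one_sub_circ_neq0 (- t) w1.
pose f u := c + log_outer u.
have df : disc_alg f by apply: discD (disc_cst c) disc_log_outer.
have cf : ccont (fun t => f (circ t)).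
  by apply: ccontD; [exact: ccont_cst|exact: ccont_log_outer].
pose g u := log_outer u * (1 - w * u)^-1.
have dg : disc_alg g by apply: discM disc_log_outer (disc_geom w1).
have cg : ccont (fun t => g (circ t)).
  by apply: ccontM; [exact: ccont_log_outer|exact: ccont_cauchy_kernel].
have clN : ccont (fun t : R => log_outer (circ (- t))).
  apply: (@ccont_comp _ (fun t : R => log_outer (circ t))).
    exact: opp_continuous.
  exact: ccont_log_outer.
have cgN : ccont (fun t => g (circ (- t))).
  apply: (@ccont_comp _ (fun t : R => g (circ t))) => //.
  exact: opp_continuous.
have E t : (ln rho.[cos t])%:C * ((1 + w * cexp (- t *i)) / (1 - w * cexp (- t *i)))
  = 2 * (f (circ t) * k t + g (circ (- t))) - (f (circ t) + log_outer (circ (- t))).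
  by rewrite ln_rho_cos -/c cexpNi /f /g /k; field; exact: k0.
under eq_cint do rewrite E.
rewrite cintB; last 2 first.
- apply: ccontM; first exact: ccont_cst.
  by apply: ccontD => //; exact: ccontM.
- exact: ccontD.
rewrite cintZ; last by apply: ccontD => //; exact: ccontM.
rewrite (@cintD _ _ _ (fun t => f (circ t) * k t))//; last exact: ccontM.
rewrite (@cintD _ _ _ (fun t => f (circ t)))//.
rewrite disc_cauchy// !disc_mean_value_conj// ?disc_mean_value//;
  try by [exact: disc_log_outer|exact: ccont_log_outer].
rewrite /f /g log_outer0 mul0r mulr0 !addr0.
rewrite -[(4 * pi)^-1]/((4 * pi)^-1) fmorphV !rmorphM /= !rmorph_nat.
have pi0 : pi%:C != 0 :> R[i] by rewrite (inj_eq (@complexI R) _ 0) gt_eqF ?pi_gt0.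
by move: pi%:C pi0 => q q0; field.
Qed.

Lemma szego_ratio w : normc w < 1 ->
  (szego (horner rho) 0)^-1 * szego (horner rho) w = outer w.
Proof.
move=> w1; rewrite !szego_outer ?normc0 ?ltr01//.
have -> : outer 0 = 1 by rewrite /outer big1// => a _; rewrite mulr0 subr0.
set e := cexp _; have e0 : e != 0.
  have : e * cexp (- ((ln (normc outer_const))%:C / 2)) = 1.
    by rewrite -cexpD subrr cexp0.
  by apply: contra_eq_neq => ->; rewrite mul0r eq_sym oner_eq0.
by rewrite mulr1 mulKf.
Qed.

End SzegoFunction.

(** * Chebyshev polynomials *)
Section Chebyshev.
Context {F : comNzRingType}.

Fixpoint chebT (n : nat) : {poly F} :=
  match n with
  | 0 => 1
  | k.+1 => match k with
            | 0 => 'X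
            | l.+1 => 2%:R * 'X * chebT k - chebT l
            end
  end.

Fixpoint chebU (n : nat) : {poly F} :=
  match n with
  | 0 => 1
  | k.+1 => match k with
            | 0 => 2%:R * 'X
            | l.+1 => 2%:R * 'X * chebU k - chebU l
            end
  end.

Lemma chebTSS n : chebT n.+2 = 2%:R * 'X * chebT n.+1 - chebT n.
Proof. by []. Qed.

Lemma chebUSS n : chebU n.+2 = 2%:R * 'X * chebU n.+1 - chebU n.
Proof. by []. Qed.

Lemma two_steps_ind (P : nat -> Prop) : P 0%N -> P 1%N ->
  (forall n, P n -> P n.+1 -> P n.+2) -> forall n, P n.
Proof.
move=> P0 P1 PS n; suff [] : P n /\ P n.+1 by [].
by elim: n => // n [? ?]; split=> //; exact: PS.
Qed.

Lemma chebTU n : 2%:R * chebT n.+2 = chebU n.+2 - chebU n.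
Proof.
elim/two_steps_ind: n => [||n IH1 IH2]; first by rewrite /=; ring.
  by rewrite /=; ring.
rewrite chebTSS mulrBr IH1 mulrCA IH2 [chebU n.+4]chebUSS.
by rewrite {2}[chebU n.+2]chebUSS; ring.
Qed.

Lemma deriv_chebT n : (chebT n.+1)^`() = n.+1%:R * chebU n.
Proof.
have d2 : (2%:R : {poly F})^`() = 0 by rewrite -polyC_natr derivC.
elim/two_steps_ind: n => [||n IH1 IH2]; first by rewrite derivX mulr1.
  by rewrite chebTSS derivB !derivM d2 derivX /= -polyC1 derivC; ring.
rewrite chebTSS derivB derivM IH1 IH2 derivM derivX d2.
have := chebTU n; rewrite chebUSS => H.
rewrite mul0r add0r mulr1 H -!natr1; ring.
Qed.

Lemma size_natr_mul k (p : {poly F}) : (size (k%:R * p)%R <= size p)%N.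
Proof. by rewrite -polyC_natr mul_polyC size_scale_leq. Qed.

Lemma size_chebT n : (size (chebT n) <= n.+1)%N.
Proof.
elim/two_steps_ind: n => [||n IH1 IH2]; first by rewrite size_poly1.
  by rewrite size_polyX.
rewrite chebTSS (leq_trans (size_polyD _ _))// size_polyN geq_max.
rewrite (leq_trans IH1) ?andbT; last by rewrite leqW.
rewrite -mulrA (leq_trans (size_natr_mul _ _))//.
rewrite mulrC (leq_trans (size_polyMleq _ _))// size_polyX addn2 /=.
by rewrite ltnS.
Qed.

Lemma size_chebT_lead n :
  (size (2%:R * chebT n.+1 - (2 ^+ n.+1)%:P * 'X^(n.+1))%R <= n.+1)%N.
Proof.
elim: n => [|n IH].
  by rewrite expr1 /= expr1 polyC_natr subrr size_poly0.
have -> : 2%:R * chebT n.+2 - (2 ^+ n.+2)%:P * 'X^(n.+2) =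
    2%:R * ((2%:R * chebT n.+1 - (2 ^+ n.+1)%:P * 'X^(n.+1)) * 'X)
    - 2%:R * chebT n.
  by rewrite chebTSS [2 ^+ n.+2]exprS polyCM polyC_natr ['X^(n.+2)]exprS; ring.
rewrite (leq_trans (size_polyD _ _))// size_polyN geq_max; apply/andP; split;
  rewrite (leq_trans (size_natr_mul _ _))//.
  by rewrite (leq_trans (size_polyMleq _ _))// size_polyX addn2.
by rewrite (leq_trans (size_chebT _)).
Qed.

End Chebyshev.

Arguments chebT {F} n : simpl never.
Arguments chebU {F} n : simpl never.

Section ChebyshevJoukowski.
Context {R : realType}.
Local Notation C := R[i].

Lemma chebT_joukowski (u : C) n : u != 0 ->
  (chebT n).[joukowski u] = (u ^+ n + u ^- n) / 2.
Proof.
move=> u0; elim/two_steps_ind: n => [||n IH1 IH2].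
- by rewrite /= hornerC expr0 invr1; field.
- by rewrite /= hornerX expr1.
rewrite chebTSS hornerD hornerN !hornerM hornerX -polyC_natr hornerC IH1 IH2.
rewrite !exprS /joukowski.
have un : u ^+ n != 0 by rewrite expf_neq0.
by move: (u ^+ n) un => v v0; field; rewrite u0 v0.
Qed.

End ChebyshevJoukowski.

(** * Bernstein-Szego polynomials *)

(** For the degrees considered the truncated subtractions are exact. *)
Lemma large_index (m n : nat) (k : 'I_m.+1) : (m.+2 <= n)%N ->
  exists2 j, (n - k = j.+2)%N & (n = k + j.+2)%N.
Proof.
move=> mn; have km := ltn_ord k.
have k2 : (k.+2 <= n)%N by apply: leq_trans mn; rewrite !ltnS.
exists (n - k.+2)%N; last by lia.
by lia.
Qed.

Section BernsteinSzego.
Context {R : realType}.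
Local Notation C := R[i].
Variables (H : {poly C}) (m : nat).
Hypotheses (sizeH : (size H <= m.+1)%N) (H0 : H`_0 = 1).
Implicit Types (u w : C) (n : nat).

(** In the Joukowski variable this is [2 ^- n * (u ^+ n * H(u^-1) +
    u ^- n * H(u))]. *)
Definition bernstein_szego n : {poly C} :=
  (2 ^- n) *: \sum_(k < m.+1) (2 * H`_k) *: chebT (n - k).

(** For [j > 1], [chebT j.+1 / j.+1 - chebT j.-1 / j.-1] is a primitive of
    [2 * chebT j]; the bound [m.+2 <= n] makes every index at least two. *)
Definition bs_primitive n : {poly C} :=
  (2 ^- n) *: \sum_(k < m.+1) H`_k *:
    ((n - k).+1%:R^-1 *: chebT (n - k).+1 -
     (n - k).-1%:R^-1 *: chebT (n - k).-1).

(** The contribution of the [k]-th coefficient of [H] to the primitive, after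
    division by [u ^+ n.+1 / (2 ^+ n.+1 * n.+1)], as a polynomial in
    [u^-1]. *)
Definition bs_psi_term n k : {poly C} :=
  n.+1%:R *: ((n - k).+1%:R^-1 *: ('X^k + 'X^(n.+1 + (n - k).+1)) -
              (n - k).-1%:R^-1 *: ('X^(k.+2) + 'X^(n.+1 + (n - k).-1))).

Definition bs_psi n : {poly C} := \sum_(k < m.+1) H`_k *: bs_psi_term n k.

Lemma natC_neq0 n : n.+1%:R != 0 :> C.
Proof. by rewrite pnatr_eq0. Qed.

Lemma deriv_bs_primitive n : (m.+2 <= n)%N ->
  (bs_primitive n)^`() = bernstein_szego n.
Proof.
move=> mn; rewrite /bs_primitive derivZ raddf_sum; congr (_ *: _).
apply: eq_bigr => k _; have [j jE _] := large_index k mn.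
rewrite jE /= derivZ derivB !derivZ !deriv_chebT.
have E l (p : {poly C}) : l.+1%:R^-1 *: (l.+1%:R * p) = p.
  by rewrite -polyC_natr mul_polyC scalerA mulVf ?natC_neq0// scale1r.
by rewrite !E -chebTU -polyC_natr mul_polyC scalerA mulrC.
Qed.

Lemma poly_coef_sum (p : {poly C}) w : (size p <= m.+1)%N ->
  p.[w] = \sum_(k < m.+1) p`_k * w ^+ k.
Proof. by move=> sp; rewrite (horner_coef_wide _ sp). Qed.

Lemma bernstein_szego_joukowski n u : (m.+2 <= n)%N -> u != 0 ->
  (bernstein_szego n).[joukowski u] =
  2 ^- n * (u ^+ n * H.[u^-1] + u ^- n * H.[u]).
Proof.
move=> mn u0; rewrite hornerZ horner_sum; congr (_ * _).
rewrite !(poly_coef_sum _ sizeH) !big_distrr -big_split /=.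
apply: eq_bigr => k _; have [j jE nE] := large_index k mn.
rewrite hornerZ chebT_joukowski// jE nE exprD exprVn.
have uj : u ^+ j.+2 != 0 by rewrite expf_neq0.
have uk : u ^+ k != 0 by rewrite expf_neq0.
by move: (u ^+ j.+2) (u ^+ k) uj uk => v v' v0 v0'; field; rewrite v0 v0'.
Qed.

Lemma bernstein_szego_monic n : (m.+2 <= n)%N ->
  (size (bernstein_szego n - 'X^n)%R <= n)%N.
Proof.
move=> mn; have [j jE nE] := large_index ord0 mn.
have -> : bernstein_szego n - 'X^n =
   (2 ^- n) *: (2 * chebT n - (2 ^+ n)%:P * 'X^n +
     \sum_(k < m) (2 * H`_k.+1) *: chebT (n - k.+1)).
  rewrite /bernstein_szego big_ord_recl /= H0 subn0 mulr1.
  have e : 2 ^- n *: ((2 ^+ n)%:P * 'X^n) = 'X^n :> {poly C}.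
    by rewrite mul_polyC scalerA mulVf ?scale1r// expf_neq0 ?pnatr_eq0.
  have e2 : 2%:R * chebT n = 2%:R *: chebT n :> {poly C}.
    by rewrite -polyC_natr mul_polyC.
  by rewrite e2 [in RHS]scalerDr scalerBr e scalerDr addrAC.
rewrite (leq_trans (size_scale_leq _ _))// (leq_trans (size_polyD _ _))//.
rewrite geq_max; apply/andP; split.
  by rewrite nE /= add0n size_chebT_lead.
apply: (leq_trans (size_sum _ _ _)); apply/bigmax_leqP => k _.
rewrite (leq_trans (size_scale_leq _ _))// (leq_trans (size_chebT _))//.
by have := ltn_ord k; lia.
Qed.

Lemma bs_primitive_joukowski n u : (m.+2 <= n)%N -> u != 0 ->
  (bs_primitive n).[joukowski u] =
  u ^+ n.+1 / (2 ^+ n.+1 * n.+1%:R) * (bs_psi n).[u^-1].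
Proof.
move=> mn u0; rewrite hornerZ !horner_sum !big_distrr /=.
apply: eq_bigr => k _; have [j jE nE] := large_index k mn.
rewrite /bs_psi_term jE /=.
have := chebT_joukowski j.+3 u0; have := chebT_joukowski j.+1 u0.
move: (chebT j.+3) (chebT j.+1) => T3 T1 E1 E3.
rewrite !(hornerZ, hornerD, hornerN, hornerXn) E1 E3 !exprVn !exprD.
have := @natC_neq0 j.+2; have := @natC_neq0 j; have := @natC_neq0 n.
have -> : u ^+ k.+2 = u ^+ k * u ^+ 2 by rewrite -exprD addn2.
have -> : u ^+ j.+3 = u ^+ j * u ^+ 3 by rewrite -exprD addn3.
have -> : u ^+ j.+1 = u ^+ j * u by rewrite -exprSr.
have -> : u ^+ n.+1 = u ^+ k * u ^+ j * u ^+ 3.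
  by rewrite -!exprD; congr (_ ^+ _); lia.
have -> : (2 : C) ^+ n.+1 = 2 ^+ n * 2 by rewrite exprSr.
have uj : u ^+ j != 0 by rewrite expf_neq0.
have uk : u ^+ k != 0 by rewrite expf_neq0.
have tn : (2 : C) ^+ n != 0 by rewrite expf_neq0 ?pnatr_eq0.
move: (u ^+ j) (u ^+ k) (2 ^+ n) uj uk tn => v v' t v0 v0' t0.
move: (n.+1%:R) (j.+1%:R) (j.+3%:R) => N J J3 N0 J0 J30.
by field; rewrite v0 v0' t0 N0 J0 J30 u0.
Qed.

End BernsteinSzego.

(** * Asymptotics of the primitives *)
Section PsiConvergence.
Context {R : realType}.
Local Notation C := R[i].
Variables (H : {poly C}) (m : nat).
Hypotheses (sizeH : (size H <= m.+1)%N).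
Implicit Types (u w : C) (n : nat).

(** The quotients of [n.+1] by [n - k + 1] and [n - k - 1] differ from [1] by
    [O (1 / j)], and the other two monomials have degree at least [j]. *)
Lemma bs_psi_term_bound n k j w (q : R) : n = (k + j.+2)%N ->
  normc w <= q -> q <= 1 ->
  normc ((bs_psi_term n k).[w] - (1 - w ^+ 2) * w ^+ k) <=
  (2 * k + 4)%:R * (j.+1%:R^-1 + q ^+ j).
Proof.
move=> nE wq q1; have q0 := le_trans (normc_ge0 w) wq.
have jE : (n - k = j.+2)%N by rewrite nE addKn.
pose a : R := k%:R / j.+3%:R; pose b : R := k.+2%:R / j.+1%:R.
have J3 : j.+3%:R != 0 :> C by rewrite pnatr_eq0.
have J1 : j.+1%:R != 0 :> C by rewrite pnatr_eq0.
have aE : n.+1%:R / j.+3%:R = 1 + a%:C.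
  rewrite /a rmorphM fmorphV !rmorph_nat; apply: (mulIf J3).
  by rewrite mulrDl !divfK// mul1r -natrD; congr _%:R; lia.
have bE : n.+1%:R / j.+1%:R = 1 + b%:C.
  rewrite /b rmorphM fmorphV !rmorph_nat; apply: (mulIf J1).
  by rewrite mulrDl !divfK// mul1r -natrD; congr _%:R; lia.
have a0 : 0 <= a by rewrite divr_ge0.
have b0 : 0 <= b by rewrite divr_ge0.
have -> : (bs_psi_term n k).[w] - (1 - w ^+ 2) * w ^+ k =
    (a%:C * w ^+ k + (1 + a%:C) * w ^+ (n.+1 + j.+3)) -
    (b%:C * w ^+ k.+2 + (1 + b%:C) * w ^+ (n.+1 + j.+1)).
  rewrite /bs_psi_term jE /= !(hornerZ, hornerD, hornerN, hornerXn) -aE -bE.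
  have -> : w ^+ k.+2 = w ^+ k * w ^+ 2 by rewrite -exprD addn2.
  have <- : n.+1%:R / j.+3%:R - 1 = a%:C by rewrite aE; ring.
  have <- : n.+1%:R / j.+1%:R - 1 = b%:C by rewrite bE; ring.
  by ring.
have wX l : normc (w ^+ l) <= 1.
  by rewrite normcX exprn_ile1 ?normc_ge0// (le_trans wq).
have wXj l : normc (w ^+ (n.+1 + l)) <= q ^+ j.
  rewrite normcX (le_trans (_ : _ <= q ^+ (n.+1 + l)))//.
    by rewrite lerXn2r ?nnegrE ?normc_ge0.
  by apply: ler_wiXn2l => //; lia.
have normR1 (x : R) : 0 <= x -> normc (1 + x%:C) = 1 + x.
  by move=> x0; rewrite -[1](rmorph1 (real_complex R)) -rmorphD normcR ger0_norm ?addr_ge0.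
apply: (le_trans (le_normc_sub _ _)).
have B1 (x : R) l l' : 0 <= x ->
   normc (x%:C * w ^+ l + (1 + x%:C) * w ^+ (n.+1 + l')) <= x + (1 + x) * q ^+ j.
  move=> x0; rewrite (le_trans (le_normcD _ _))// !normcM normcR ger0_norm// normR1//.
  by rewrite lerD// ?ler_piMr// ler_wpM2l ?addr_ge0.
apply: (le_trans (lerD (B1 a k j.+3 a0) (B1 b k.+2 j.+1 b0))).
have aj : a <= k%:R / j.+1%:R.
  by rewrite ler_wpM2l// lef_pV2 ?posrE ?ltr0n// ler_nat; lia.
have ak : 1 + a <= k.+1%:R.
  rewrite -natr1 addrC lerD2r (le_trans aj)// ler_pdivrMr ?ltr0n//.
  by rewrite ler_peMr// ler1n.
have bk : 1 + b <= k.+3%:R.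
  rewrite -[k.+3%:R]natr1 addrC lerD2r ler_pdivrMr ?ltr0n//.
  by rewrite ler_peMr// ler1n.
have qj : 0 <= q ^+ j by rewrite exprn_ge0.
have J0 : 0 <= j.+1%:R^-1 :> R by rewrite invr_ge0.
have ak' := ler_wpM2r qj ak; have bk' := ler_wpM2r qj bk.
have step : a + (1 + a) * q ^+ j + (b + (1 + b) * q ^+ j) <=
  (k%:R / j.+1%:R + k.+1%:R * q ^+ j) + (k.+2%:R / j.+1%:R + k.+3%:R * q ^+ j).
  by rewrite lerD// lerD.
apply: (le_trans step).
move: J0 qj; move: (j.+1%:R^-1) (q ^+ j) => x y x0 y0.
rewrite natrD natrM -[k.+3]addn3 -[k.+2]addn2 -[k.+1]addn1 !natrD.
have : 0 <= k%:R :> R by [].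
by move: (k%:R) => K K0; nra.
Qed.

Lemma bs_psi_cvg (q : R) : 0 <= q < 1 -> forall eps, 0 < eps ->
  exists N, forall n w, (N <= n)%N -> normc w <= q ->
    normc ((bs_psi H m n).[w] - (1 - w ^+ 2) * H.[w]) <= eps.
Proof.
move=> q01 e e0; have /andP[q0 q1] := q01.
pose K : R := \sum_(k < m.+1) normc H`_k * (2 * k + 4)%:R.
have K0 : 0 <= K by rewrite sumr_ge0// => k _; rewrite mulr_ge0 ?normc_ge0.
have e2 : 0 < e / 2 by rewrite divr_gt0.
have [L1 hL1] := @geometric_small R q K q01 K0 _ e2.
pose L2 := Num.truncn (K / (e / 2)).
have hL2 l : (L2 <= l)%N -> K * l.+1%:R^-1 <= e / 2.
  move=> Ll; rewrite ler_pdivrMr ?ltr0n// mulrC -ler_pdivrMr//.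
  rewrite (le_trans (ltW (truncnS_gt _)))// ler_nat ltnS//.
exists (m + (L1 + L2)).+2 => n w mn wq.
have -> : (bs_psi H m n).[w] - (1 - w ^+ 2) * H.[w] =
   \sum_(k < m.+1) H`_k * ((bs_psi_term n k).[w] - (1 - w ^+ 2) * w ^+ k).
  rewrite (poly_coef_sum w sizeH) big_distrr /= /bs_psi horner_sum -sumrB.
  by apply: eq_bigr => k _; rewrite hornerZ; ring.
apply: (le_trans (normc_sum _ _ _)).
have -> : e = e / 2 + e / 2 by rewrite -splitr.
set l := (n - m.+2)%N; have lL1 : (L1 <= l)%N by lia.
have lL2 : (L2 <= l)%N by lia.
apply: (@le_trans _ _ (K * (l.+1%:R^-1 + q ^+ l))); last first.
  rewrite mulrDr lerD ?hL2// (le_trans _ hL1)// ler_wpM2l//.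
  by apply: ler_wiXn2l => //; rewrite ?ltW.
rewrite /K big_distrl /=; apply: ler_sum => k _.
have nm2 : (m.+2 <= n)%N by lia.
have [j jE nE] := large_index k nm2.
rewrite normcM -mulrA ler_wpM2l ?normc_ge0//.
apply: (le_trans (bs_psi_term_bound nE wq (ltW q1))).
rewrite ler_wpM2l// lerD//.
  by rewrite lef_pV2 ?posrE ?ltr0n// ler_nat ltnS; have := ltn_ord k; lia.
by apply: ler_wiXn2l => //; [exact: ltW|have := ltn_ord k; lia].
Qed.

End PsiConvergence.

Section Primitives.
Context {R : realType}.
Local Notation C := R[i].
Implicit Types (p : {poly C}) (u : C).

Definition primitive p : {poly C} := \poly_(i < (size p).+1) (p`_i.-1 / i%:R).

Lemma deriv_primitive p : (primitive p)^`() = p.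
Proof.
apply/polyP => i; rewrite coef_deriv coef_poly ltnS.
case: ltnP => [_|pi].
  by rewrite -[_ *+ _]mulr_natr /= divfK ?pnatr_eq0.
by rewrite mul0rn nth_default.
Qed.

Lemma size_primitive p : (size (primitive p) <= (size p).+1)%N.
Proof. exact: size_poly. Qed.

(** At infinity [p (joukowski u)] has a pole of order at most [N]; this is the
    polynomial in [u^-1] which is left after [u ^+ N] is factored out. *)
Definition pull_infinity N p : {poly C} :=
  \sum_(j < N.+1) p`_j *: ((2 ^- j) *: (1 + 'X^2) ^+ j * 'X^(N - j)).

Lemma pull_infinityP N p u : (size p <= N.+1)%N -> u != 0 ->
  p.[joukowski u] = u ^+ N * (pull_infinity N p).[u^-1].
Proof.
move=> sp u0; rewrite (horner_coef_wide _ sp) horner_sum big_distrr /=.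
apply: eq_bigr => j _; rewrite hornerZ hornerM hornerZ horner_exp hornerD.
rewrite hornerC !hornerXn mulrCA; congr (_ * _).
have -> : joukowski u = u * (2^-1 * (1 + u^-1 ^+ 2)) by rewrite /joukowski; field.
rewrite !exprMn !exprVn.
have -> : u ^+ N = u ^+ j * u ^+ (N - j) by rewrite -exprD subnKC// -ltnS.
have uj : u ^+ (N - j) != 0 by rewrite expf_neq0.
by move: ((1 + _) ^+ j) (2 ^- j) (u ^+ (N - j)) uj => A B v v0; field.
Qed.

End Primitives.

(** * Positivity of the denominator *)
Section WeightMeasure.
Context {R : realType}.
Variables (rho : {poly R})
  (mu : {finite_measure set (measurableTypeR R) -> \bar R}).

Definition weight (x : R) : R := chebyshev_density x / rho.[x].

Local Notation leb := (@lebesgue_measure R).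
Local Notation Ipm := (`[-1, 1]%classic : set (measurableTypeR R)).

Hypothesis rho_ge0 : forall x : R, -1 <= x <= 1 -> 0 <= rho.[x].
Hypothesis muE : forall A : set (measurableTypeR R), measurable A ->
  mu A = (\int[leb]_(x in A `&` `[(-1)%R, 1%R]) (weight x)%:E)%E.

Lemma weight_ge0 x : -1 <= x <= 1 -> 0 <= weight x.
Proof.
by move=> x1; rewrite divr_ge0 ?rho_ge0// /chebyshev_density invr_ge0 sqrtr_ge0.
Qed.

Lemma continuous_hornerR (p : {poly R}) : continuous (horner p).
Proof.
by move=> x; apply/differentiable_continuous/derivable1_diffP/derivable_horner.
Qed.

Lemma continuous_sqrt_density : continuous (fun x : R => Num.sqrt (1 - x ^+ 2)).
Proof.
move=> x; apply: (@continuous_comp _ _ _ (fun x : R => 1 - x ^+ 2) Num.sqrt).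
  apply: contB => y; first exact: cvg_cst.
  by under eq_fun do rewrite expr2; apply: contM => z; exact: cvg_id.
exact: sqrt_continuous.
Qed.

Lemma measurable_inv_ge0 (f : R -> R) : continuous f ->
  (forall x, -1 <= x <= 1 -> 0 <= f x) ->
  measurable_fun Ipm (fun x => (f x)^-1).
Proof.
move=> cf f0; apply: (@eq_measurable_fun _ _ _ _ _ (fun x : R => f x `^ (-1))).
  by move=> x; rewrite inE /= in_itv/= => x1; rewrite powR_inv1// f0.
apply: measurable_funTS; apply: (measurableT_comp (measurable_powR _)).
exact: continuous_measurable_fun.
Qed.

Lemma measurable_weight : measurable_fun Ipm weight.
Proof.
apply: measurable_funM.
  apply: measurable_inv_ge0; first exact: continuous_sqrt_density.
  by move=> x _; exact: sqrtr_ge0.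
apply: measurable_inv_ge0 => //; exact: continuous_hornerR.
Qed.

Lemma mu_itv_ge (b c kappa : R) : -1 < b -> b <= c -> c < 1 -> 0 < kappa ->
  (forall x, b <= x <= c -> 0 < rho.[x] <= kappa) ->
  (((c - b) / kappa)%:E <= mu `[b, c]%classic)%E.
Proof.
move=> b1 bc c1 k0 rk.
have sub : `[b, c]%classic `<=` `[-1, 1]%classic.
  move=> x /=; rewrite !in_itv/= => /andP[bx xc].
  by rewrite (le_trans (ltW b1)) ?(le_trans xc)// ltW.
rewrite muE// setIidl//.
have -> : ((c - b) / kappa)%:E =
    (\int[leb]_(x in `[b, c]) (cst (kappa^-1)%:E x))%E.
  rewrite integral_cst//= lebesgue_measure_itv/= lte_fin.
  move: bc; case: ltgtP => // [_ _|->]; first by rewrite -EFinB -EFinM mulrC.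
  by rewrite subrr mul0r mule0.
apply: ge0_le_integral => //.
- by move=> x _; rewrite lee_fin invr_ge0 ltW.
- apply/measurable_EFinP; apply: measurable_funS measurable_weight => //.
- move=> x /=; rewrite in_itv/= => xbc; rewrite lee_fin.
  have /andP[r0 rk'] := rk x xbc; have /andP[bx xc] := xbc.
  rewrite /weight -[kappa^-1]mul1r ler_pM ?invr_ge0 ?(ltW k0)//; last first.
    by rewrite lef_pV2.
  have s0 : 0 < Num.sqrt (1 - x ^+ 2) by rewrite sqrtr_gt0; nra.
  rewrite /chebyshev_density -[leLHS]invr1 lef_pV2 ?posrE//.
  by rewrite -[leRHS]sqrtr1 ler_wsqrtr// lerBlDr lerDl sqr_ge0.
Qed.

(** Finiteness of the measure excludes zeros of [rho]: near a zero [a] the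
    weight is at least a multiple of [1 / |x - a|], so the points at distance
    between [e / 2] and [e] from [a] carry a mass bounded below, although they
    shrink to a null point as [e] tends to zero. *)
Lemma rho_gt0 : rho != 0 -> forall x : R, -1 <= x <= 1 -> 0 < rho.[x].
Proof.
move=> rho0 a a1; rewrite lt_def rho_ge0// andbT; apply/negP => ra.
have [k [q]] := multiplicity_XsubC rho a; rewrite rho0 /= => qa rhoE.
have k0 : (0 < k)%N.
  case: k rhoE => // rhoE; move: qa.
  by rewrite /root -[q]mulr1 -[1](expr0 ('X - a%:P)) -rhoE ra.
have [M M0 qM] := poly_disc_bounded (map_poly (real_complex R) q).
have {}qM x : -1 <= x <= 1 -> `|q.[x]| <= M.
  move=> x1; have := qM x%:C; rewrite (horner_map (real_complex R)).
  rewrite [normc (real_complex R x)]normcR [normc (real_complex R _)]normcR.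
  apply.
  by rewrite ler_norml.
have Mp : 0 < M + 1 by rewrite ltr_pwDr.
have [d0 d0p qd] : exists2 d, 0 < d & forall x, `|x - a| < d -> q.[x] != 0.
  have qa' : q.[a] != 0 by [].
  have /cvgrPdist_lt : horner q x @[x --> a] --> q.[a] by exact: continuous_hornerR.
  move=> /(_ `|q.[a]|); rewrite normr_gt0 qa' => /(_ isT) /nbhs_ballP[d /= dp h].
  exists d => // x xa; apply/eqP => qx0; have := h x.
  rewrite /ball /= distrC => /(_ xa); rewrite /= qx0 subr0 ltxx//.
pose d := Num.min (d0 / 2) 2^-1.
have dp : 0 < d by rewrite lt_min divr_gt0//= invr_gt0.
have dd0 : d < d0.
  rewrite (le_lt_trans (_ : _ <= d0 / 2)) ?ge_min ?lexx// ltr_pdivrMr//.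
  by rewrite mulr_natr mulr2n ltrDl.
have d2 : d <= 2^-1 by rewrite ge_min lexx orbT.
have key (e : R) x : 0 < e <= d -> -1 <= x <= 1 -> e / 2 <= `|x - a| <= e ->
    0 < rho.[x] <= (M + 1) * e.
  move=> /andP[e0 ed] x1 /andP[xe1 xe2].
  have xa : `|x - a| < d0 by rewrite (le_lt_trans xe2)// (le_lt_trans ed).
  have xa0 : x - a != 0 by rewrite -normr_gt0 (lt_le_trans _ xe1)// divr_gt0.
  have rx : rho.[x] != 0.
    by rewrite rhoE hornerM horner_exp hornerXsubC mulf_neq0 ?qd// expf_neq0.
  rewrite lt_def rx rho_ge0//= (le_trans (ler_norm _))//.
  rewrite rhoE hornerM horner_exp hornerXsubC normrM normrX.
  rewrite ler_pM//; first by rewrite (le_trans (qM _ x1))// lerDl.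
  rewrite -(prednK k0) exprS (le_trans _ xe2)// ler_piMr// exprn_ile1//.
  by rewrite (le_trans xe2)// (le_trans ed)// (le_trans d2)// invf_le1// ler1n.
pose e (n : nat) := d / n.+1%:R.
have e0 n : 0 < e n by rewrite divr_gt0.
have ed n : e n <= d by rewrite ler_pdivrMr ?ltr0n// ler_peMr ?ler1n// ltW.
pose F n : set (measurableTypeR R) := `[a - e n, a + e n]%classic.
have Fge n : ((2 * (M + 1))^-1%:E <= mu (F n))%E.
  have e2 : e n / 2 <= e n by rewrite ler_pdivrMr// ler_peMr// ?ltW// ltr1n.
  have e20 : 0 < e n / 2 by rewrite divr_gt0.
  have ed' := ed n; have e0' := e0 n.
  have K0 : 0 < (M + 1) * e n by rewrite mulr_gt0.
  have valE : ((2 * (M + 1))^-1 = (e n / 2) / ((M + 1) * e n))%R.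
    by field; rewrite !gt_eqF.
  have /andP[am1 a1'] := a1.
  have [a0|a0] := leP a 0.
  - apply: (@le_trans _ _ (mu `[a + e n / 2, a + e n]%classic)); last first.
      apply: le_measure; rewrite ?inE; [exact: measurable_itv..|] => x.
      rewrite /F /= !in_itv/=.
      by move=> /andP[? ?]; apply/andP; split; lra.
    have -> : (2 * (M + 1))^-1 = ((a + e n) - (a + e n / 2)) / ((M + 1) * e n).
      by rewrite valE; congr (_ / _); field.
    apply: mu_itv_ge => //; try lra.
    move=> x /andP[x1 x2]; apply: key; first by rewrite e0'.
      by apply/andP; split; lra.
    by rewrite ger0_norm; [apply/andP; split; lra|lra].
  - apply: (@le_trans _ _ (mu `[a - e n, a - e n / 2]%classic)); last first.
      apply: le_measure; rewrite ?inE; [exact: measurable_itv..|] => x.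
      rewrite /F /= !in_itv/=.
      by move=> /andP[? ?]; apply/andP; split; lra.
    have -> : (2 * (M + 1))^-1 = ((a - e n / 2) - (a - e n)) / ((M + 1) * e n).
      by rewrite valE; congr (_ / _); field.
    apply: mu_itv_ge => //; try lra.
    move=> x /andP[x1 x2]; apply: key; first by rewrite e0'.
      by apply/andP; split; lra.
    by rewrite ler0_norm; [apply/andP; split; lra|lra].
have Fcap : \bigcap_n F n = [set a].
  apply/seteqP; split=> [x Fx|x ->]; last first.
    by move=> n _; rewrite /F /= in_itv/= lerBlDr lerDl ltW//= lerDl ltW.
  apply/eqP; rewrite -subr_eq0 -normr_le0; apply/ler_addgt0Pl => eps eps0.
  rewrite addr0; pose n := Num.truncn (d / eps).
  have := Fx n I; rewrite /F /= in_itv/= => /andP[x1 x2].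
  apply: (@le_trans _ _ (e n)); first by rewrite ler_norml; apply/andP; split; lra.
  rewrite /e ler_pdivrMr ?ltr0n// mulrC -ler_pdivrMr//.
  exact/ltW/truncnS_gt.
have Fcvg : (mu \o F) x @[x --> \oo] --> mu [set a].
  rewrite -Fcap; apply: nonincreasing_cvg_mu.
  - by rewrite ltey_eq fin_num_measure//; exact: measurable_itv.
  - by move=> n; exact: measurable_itv.
  - by rewrite Fcap; exact: measurable_set1.
  - move=> n n' nn'; apply/subsetPset => x; rewrite /F /= !in_itv/=.
    have : e n' <= e n by rewrite /e ler_pM2l// lef_pV2 ?posrE ?ltr0n// ler_nat.
    by move=> ? /andP[? ?]; apply/andP; split; lra.
have mua : mu [set a] = 0%E.
  rewrite muE; last exact: measurable_set1.
  rewrite setIidl ?integral_set1// => x ->; rewrite /= in_itv//=.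
have : ((2 * (M + 1))^-1%:E <= limn (mu \o F))%E.
  apply: lime_ge; first by apply/cvg_ex; exists (mu [set a]).
  by apply: nearW => n; exact: Fge.
rewrite (cvg_lim _ Fcvg)// mua lee_fin leNgt invr_gt0 mulr_gt0//.
Qed.

End WeightMeasure.

(** * The substitution x = cos t *)
Section ChebyshevSubstitution.
Context {R : realType}.
Variables (rho : {poly R}).
Hypothesis rho_gt0 : forall x : R, -1 <= x <= 1 -> 0 < rho.[x].

Local Notation leb := (@lebesgue_measure R).

Lemma ler_cos : {in `[(0 : R), pi] &, {mono cos : x y /~ y <= x}}.
Proof. by move=> x y xI yI; rewrite leNgt ltr_cos// -leNgt. Qed.

Lemma cos_pm1 (t : R) : -1 <= cos t <= 1.
Proof. by rewrite cos_geN1 cos_le1. Qed.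

Lemma continuous_cos_quotient (f : R -> R) : continuous f ->
  continuous (fun t => f (cos t) / rho.[cos t]).
Proof.
move=> cf; apply: contM => [t|].
  by apply: (@continuous_comp _ _ _ cos f); [exact: continuous_cos|exact: cf].
apply: contV => t; first by rewrite gt_eqF// rho_gt0 ?cos_pm1.
by apply: (@continuous_comp _ _ _ cos (horner rho));
  [exact: continuous_cos|exact: continuous_hornerR].
Qed.

(** The weight is unbounded at both ends of the interval, so the change of
    variables [x = cos t] is first made away from them. *)
Lemma chebyshev_substitution_inner (f : R -> R) (d : R) : continuous f ->
  0 < d -> d < pi / 2 ->
  (\int[leb]_(x in `[(- cos d)%R, cos d]) (f x * weight rho x)%:E =
   \int[leb]_(t in `[d, (pi - d)%R]) (f (cos t) / rho.[cos t])%:E)%E.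
Proof.
move=> cf d0 dpi.
have cpd : cos (pi - d) = - cos d by rewrite addrC cosDpi cosN.
have c1 : cos d < 1.
  by rewrite -(cos0 R) ltr_cos// ?in_itv/= ?lexx ?pi_ge0//; have := pi_gt0 R; lra.
have dcos : derive1 (@cos R) = (fun t => - sin t).
  by apply/funext => t; rewrite derive1E; apply: derive_val.
have csinN : continuous (fun t : R => - sin t).
  by apply: contN => t; exact: continuous_sin.
have := @integration_by_substitution_decreasing R cos
  (fun x => f x * weight rho x) d (pi - d).
rewrite cpd => ->.
- apply: eq_integral => t; rewrite inE /= in_itv/= => /andP[dt td].
  congr EFin; rewrite dcos /= opprK /weight /chebyshev_density.
  have st : 0 < sin t by rewrite sin_gt0_pi//; apply/andP; split; lra.
  rewrite -[LHS]/(f (cos t) *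
    ((Num.sqrt (1 - cos t ^+ 2))^-1 / rho.[cos t]) * sin t).
  rewrite -sin2cos2 sqrtr_sqr gtr0_norm//.
  have r0 : 0 < rho.[cos t] by rewrite rho_gt0 ?cos_pm1.
  by field; rewrite !gt_eqF.
- by have := pi_gt0 R; lra.
- move=> x y; rewrite !in_itv/= => /andP[dx xd] /andP[dy yd] xy.
  rewrite ltr_cos//; rewrite in_itv/=; apply/andP; split; lra.
- by rewrite dcos => x _; exact: csinN.
- rewrite dcos; apply/cvg_ex; exists (- sin d).
  exact/cvg_at_right_filter/csinN.
- rewrite dcos; apply/cvg_ex; exists (- sin (pi - d)).
  exact/cvg_at_left_filter/csinN.
- split=> [x _||]; first exact: derivable_cos.
    exact/cvg_at_right_filter/continuous_cos.
  exact/cvg_at_left_filter/continuous_cos.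
- apply: continuous_in_subspaceT => x; rewrite inE /= in_itv/= => /andP[x1 x2].
  have s0 : 0 < Num.sqrt (1 - x ^+ 2) by rewrite sqrtr_gt0; nra.
  apply: cvgM; first exact: cf.
  apply: cvgM; apply: cvgV.
  + by rewrite gt_eqF.
  + exact: continuous_sqrt_density.
  + by rewrite gt_eqF// rho_gt0//; apply/andP; split; lra.
  + exact: continuous_hornerR.
Qed.

(** The inner segments exhaust the interval, and for a nonnegative integrand
    monotone convergence applies on both sides. *)
Lemma chebyshev_substitution (f : R -> R) : continuous f ->
  (forall x, -1 <= x <= 1 -> 0 <= f x) ->
  (\int[leb]_(x in `[(-1)%R, 1%R]) (f x * weight rho x)%:E =
   \int[leb]_(t in `[0%R, pi]) (f (cos t) / rho.[cos t])%:E)%E.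
Proof.
move=> cf f0.
have rho_ge0 x : -1 <= x <= 1 -> 0 <= rho.[x] by move=> /rho_gt0/ltW.
have mw : measurable_fun (`[-1, 1]%classic : set (measurableTypeR R))
    (fun x : measurableTypeR R => (f x * weight rho x)%:E).
  apply/measurable_EFinP/measurable_funM.
    by apply: measurable_funTS; exact: continuous_measurable_fun.
  exact: measurable_weight.
have mc (A : set (measurableTypeR R)) : measurable_fun A
    (fun t : measurableTypeR R => (f (cos t) / rho.[cos t])%:E).
  apply/measurable_EFinP; apply: measurable_funTS.
  by apply: continuous_measurable_fun; exact: continuous_cos_quotient.
pose d (n : nat) : R := pi / n.+3%:R.
have pi0 := pi_gt0 R.
have d0 n : 0 < d n by rewrite divr_gt0.
have d2 n : d n < pi / 2 by rewrite ltr_pM2l// ltf_pV2 ?posrE ?ltr0n// ltr_nat.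
have dd n n' : (n <= n')%N -> d n' <= d n.
  by move=> nn; rewrite ler_pM2l// lef_pV2 ?posrE ?ltr0n// ler_nat.
have d_small eps : 0 < eps -> exists n, d n < eps.
  move=> eps0; exists (Num.truncn (pi / eps)).
  rewrite ltr_pdivrMr ?ltr0n// mulrC -ltr_pdivrMr//.
  rewrite (lt_le_trans (truncnS_gt _))// ler_nat.
  exact: (leq_trans (leqnSn _) (leqnSn _)).
pose A n : set (measurableTypeR R) := `[(- cos (d n)), cos (d n)]%classic.
pose B n : set (measurableTypeR R) := `[d n, pi - d n]%classic.
have cosd n n' : (n <= n')%N -> cos (d n) <= cos (d n').
  move=> nn; have d1 := d0 n; have d1' := d0 n'; have d3 := d2 n; have d3' := d2 n'.
  rewrite ler_cos ?dd//; rewrite in_itv/=; apply/andP; split; lra.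
have cosd1 n : cos (d n) < 1.
  have d1 := d0 n; have d3 := d2 n.
  by rewrite -(cos0 R) ltr_cos// in_itv/=; apply/andP; split; lra.
have Acup : \bigcup_n A n = `](-1), 1[%classic.
  apply/seteqP; split=> [x [n _]|x].
    rewrite /A /= !in_itv/= => /andP[x1 x2]; have := cosd1 n => c1.
    by apply/andP; split; lra.
  rewrite /= in_itv/= => x1.
  pose y := `|x|; have y1 : -1 <= y < 1.
    by rewrite ltr_norml x1 andbT (le_trans _ (normr_ge0 x))// lerN10.
  have [n dn] := d_small (acos y) (acos_gt0 y1).
  exists n => //; rewrite /A /= in_itv/= -ler_norml -/y.
  have /andP[y1a y1b] := y1.
  have yb : -1 <= y <= 1 by rewrite y1a ltW.
  have d1 := d0 n; have d3 := d2 n.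
  have aI : acos y \in `[0, pi] by rewrite in_itv/= acos_ge0 ?acos_lepi.
  have dI : d n \in `[0, pi] by rewrite in_itv/=; apply/andP; split; lra.
  by rewrite -[leLHS](@acosK R) ?in_itv//= (ler_cos dI aI) ltW.
have Bcup : \bigcup_n B n = `]0, pi[%classic.
  apply/seteqP; split=> [x [n _]|x].
    rewrite /B /= !in_itv/= => /andP[x1 x2]; have := d0 n => c1.
    by apply/andP; split; lra.
  rewrite /= in_itv/= => /andP[x0 xpi].
  have [n dn] : exists n, d n < Num.min x (pi - x).
    by apply: d_small; rewrite lt_min x0 subr_gt0.
  move: dn; rewrite lt_min => /andP[dn1 dn2].
  by exists n => //; rewrite /B /= in_itv/=; apply/andP; split; lra.
have Asub n : A n `<=` `[(-1)%R, 1%R]%classic.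
  move=> x; rewrite /A /= !in_itv/= => /andP[x1 x2]; have := cosd1 n => c1.
  by apply/andP; split; lra.
have cvgA : (\int[leb]_(x in A n) (f x * weight rho x)%:E)%E @[n --> \oo] -->
    (\int[leb]_(x in `[(-1)%R, 1%R]) (f x * weight rho x)%:E)%E.
  rewrite (integral_itv_bndoo true false); last first.
    by apply: measurable_funS mw => //; exact: subset_itv_oo_cc.
  rewrite -Acup; apply: ge0_nondecreasing_set_cvg_integral => //.
  - move=> n n' nn; apply/subsetPset => x; rewrite /A /= !in_itv/=.
    by move=> /andP[? ?]; have := cosd _ _ nn; move=> ?; apply/andP; split; lra.
  - by move=> n; exact: measurable_itv.
  - by move=> n; exact: measurable_funS mw.
  - move=> n x /Asub; rewrite /= in_itv/= => x1.
    by rewrite lee_fin mulr_ge0 ?f0 ?weight_ge0.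
have cvgB : (\int[leb]_(t in B n) (f (cos t) / rho.[cos t])%:E)%E @[n --> \oo] -->
    (\int[leb]_(t in `[0%R, pi]) (f (cos t) / rho.[cos t])%:E)%E.
  rewrite (integral_itv_bndoo true false); last exact: mc.
  rewrite -Bcup; apply: ge0_nondecreasing_set_cvg_integral => //.
  - move=> n n' nn; apply/subsetPset => x; rewrite /B /= !in_itv/=.
    by move=> /andP[? ?]; have := dd _ _ nn; move=> ?; apply/andP; split; lra.
  - by move=> n; exact: measurable_itv.
  - by move=> n x _; rewrite lee_fin divr_ge0 ?f0 ?rho_ge0 ?cos_pm1.
move: cvgA; under eq_fun do rewrite chebyshev_substitution_inner//.
by move=> /cvg_lim <-//; move/cvg_lim: cvgB => ->.
Qed.

End ChebyshevSubstitution.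

(** * Integrals of polynomials as integrals over the circle *)
Section WeightIntegral.
Context {R : realType}.
Variables (rho : {poly R})
  (mu : {finite_measure set (measurableTypeR R) -> \bar R}).

Local Notation leb := (@lebesgue_measure R).
Local Notation Ipm := (`[-1, 1]%classic : set (measurableTypeR R)).

Hypothesis rho_gt0 : forall x : R, -1 <= x <= 1 -> 0 < rho.[x].
Hypothesis muE : forall A : set (measurableTypeR R), measurable A ->
  mu A = (\int[leb]_(x in A `&` `[(-1)%R, 1%R]) (weight rho x)%:E)%E.

Let rho_ge0 x : -1 <= x <= 1 -> 0 <= rho.[x].
Proof. by move=> /rho_gt0/ltW. Qed.

Lemma continuous_bounded (f : R -> R) : continuous f ->
  exists2 M, 0 <= M & forall x, -1 <= x <= 1 -> `|f x| <= M.
Proof.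
move=> cf; have cn : {within `[(-1 : R), 1], continuous (fun x => `|f x|)}.
  apply: continuous_subspaceT => x.
  by apply: (@continuous_comp _ _ _ f); [exact: cf|exact: norm_continuous].
have [|c _ cM] := EVT_max _ cn; first by rewrite ge0_cp.
by exists `|f c| => // x x1; apply: cM; rewrite in_itv.
Qed.

Lemma mu_integrable (f : R -> R) : continuous f ->
  mu.-integrable Ipm (EFin \o f).
Proof.
move=> cf; have [M M0 fM] := continuous_bounded cf.
apply: measurable_bounded_integrable; first exact: measurable_itv.
- by rewrite ltey_eq fin_num_measure//; exact: measurable_itv.
- by apply: measurable_funTS; exact: continuous_measurable_fun.
- exists M; split; rewrite ?num_real// => N MN x; rewrite /= in_itv/= => x1.
  by rewrite (le_trans (fM _ x1))// ltW.
Qed.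

Lemma mu_null_dominates : mu `<< leb.
Proof.
apply/null_content_dominatesP => A mA A0; rewrite muE//.
have mAI : measurable (A `&` Ipm) by apply: measurableI => //; exact: measurable_itv.
apply: null_set_integral => //.
- apply: measurable_funS (measurable_itv _) _ _; first exact: subIsetr.
  by apply/measurable_EFinP; exact: measurable_weight.
- apply/eqP; rewrite eq_le measure_ge0 andbT -[leRHS]A0.
  by rewrite le_measure ?inE//; exact: subIsetl.
Qed.

(** By uniqueness of Radon-Nikodym derivatives the weight is the derivative of
    [mu]. *)
Lemma integral_weight (f : R -> R) : continuous f ->
  (\int[mu]_(x in Ipm) (f x)%:E =
   \int[leb]_(x in Ipm) (f x * weight rho x)%:E)%E.
Proof.
move=> cf; have mI : measurable Ipm by exact: measurable_itv.
rewrite -(Radon_Nikodym_change_of_variables mu_null_dominates)//; last first.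
  exact: mu_integrable.
apply: ae_eq_integral => //.
- apply: emeasurable_funM.
    apply/measurable_EFinP; apply: measurable_funTS.
    exact: continuous_measurable_fun.
  apply: (measurable_int leb); apply: (integrableS _ _ (@subsetT _ _)) => //=.
  by apply: Radon_Nikodym_integrable; exact: mu_null_dominates.
- apply/measurable_EFinP/measurable_funM; last exact: measurable_weight.
  by apply: measurable_funTS; exact: continuous_measurable_fun.
- rewrite (_ : (fun x => (f x * weight rho x)%:E) =
     ((fun x => (f x)%:E) \* (fun x => (weight rho x)%:E))%E); last first.
    by apply/funext => x; rewrite EFinM.
  apply: ae_eqe_mul2l.
  rewrite Radon_NikodymE//=; first exact: mu_null_dominates.
  move=> dom; case: cid => /= h [h1 h2 h3].
  apply: integral_ae_eq => //=.
  + exact: integrableS h2.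
  + by apply/measurable_EFinP; exact: measurable_weight.
  + by move=> E EI mE; rewrite -h3// -[LHS]/(mu E) muE// setIidl.
Qed.

Lemma Rintegral_even (g : R -> R) : continuous g -> (forall t, g (- t) = g t) ->
  Rintegral leb `[- pi, pi] g = 2 * Rintegral leb `[0, pi] g.
Proof.
move=> cg ge; have pi0 := pi_gt0 R.
have := @Rintegral_itvB R g (BLeft (- pi)) (BRight pi) 0
  (continuous_segment_integrable _ _ cg).
rewrite !bnd_simp oppr_le0 pi_ge0 => /(_ isT isT) H.
have H1 : Rintegral leb `[- pi, 0] g = Rintegral leb `[0, pi] g.
  rewrite /Rintegral; congr fine.
  have := @integration_by_substitution_oppr R g 0 pi (pi_ge0 R).
  rewrite oppr0 => -> //; last exact: continuous_subspaceT.
  by apply: eq_integral => t _ /=; rewrite ge.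
have H2 : Rintegral leb `]0, pi] g = Rintegral leb `[0, pi] g.
  apply: Rintegral_itv_obnd_cbnd.
  apply: (integrableS _ _ _ (continuous_segment_integrable 0 pi cg)) => //.
  exact: subset_itv_oc_cc.
by move: H; rewrite H1 H2 => /eqP; rewrite subr_eq mulr_natl mulr2n => /eqP.
Qed.

Lemma Rintegral_mu_cos (f : R -> R) : continuous f ->
  Rintegral mu Ipm f =
  2^-1 * Rintegral leb `[- pi, pi] (fun t => f (cos t) / rho.[cos t]).
Proof.
move=> cf.
rewrite Rintegral_even; last 2 first.
- exact: continuous_cos_quotient.
- by move=> t; rewrite cosN.
rewrite mulKf ?pnatr_eq0//.
have [M M0 fM] := continuous_bounded cf.
have base (g : R -> R) : continuous g -> (forall x, -1 <= x <= 1 -> 0 <= g x) ->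
  Rintegral mu Ipm g = Rintegral leb `[0, pi] (fun t => g (cos t) / rho.[cos t]).
  by move=> cg g0; rewrite /Rintegral integral_weight// chebyshev_substitution.
have cM : continuous (fun _ : R => M) by move=> x; exact: cvg_cst.
have cfM : continuous (fun x => f x + M) by exact: contD.
have mI : measurable Ipm by exact: measurable_itv.
(* A constant is added so that the substitution applies to a nonnegative
   function. *)
have -> : Rintegral mu Ipm f =
    Rintegral mu Ipm (fun x => f x + M) - Rintegral mu Ipm (fun=> M).
  rewrite RintegralD//; try exact: mu_integrable.
  by rewrite addrK.
rewrite !base//; last first.
  by move=> x /fM; rewrite ler_norml => /andP[h _]; rewrite -lerBlDr sub0r.
have cM' := continuous_cos_quotient rho_gt0 cM.
have cf' := continuous_cos_quotient rho_gt0 cf.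
under eq_Rintegral do rewrite mulrDl.
rewrite RintegralD ?addrK//; exact: continuous_segment_integrable.
Qed.

Lemma ccont_ofR (p : {poly R[i]}) : ccont (fun x : R => p.[x%:C]).
Proof. by apply: ccont_poly; apply: ccontR => x; exact: cvg_id. Qed.

Lemma poly_integral_cos (p : {poly R[i]}) : poly_integral mu p =
  2^-1 * cint (- pi) pi (fun t : R => p.[(cos t)%:C] / (rho.[cos t])%:C).
Proof.
have [cr ci] := ccont_ofR p.
have E (z : R[i]) (r : R) : Re (z / r%:C) = Re z / r /\ Im (z / r%:C) = Im z / r.
  by rewrite -fmorphV cReM cImM /= !mulr0 subr0 add0r.
have h2 : 2^-1 = (2^-1)%:C :> R[i] by rewrite fmorphV rmorph_nat.
rewrite /poly_integral /cintegral h2; apply: complex_eq.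
  rewrite cReM /= mul0r subr0 Rintegral_mu_cos//; congr (_ * _).
  by apply: eq_Rintegral => t _; rewrite (E _ _).1.
rewrite cImM /= mul0r addr0 Rintegral_mu_cos//; congr (_ * _).
by apply: eq_Rintegral => t _; rewrite (E _ _).2.
Qed.

End WeightIntegral.

(** * Orthogonality and uniqueness *)
Section NonnegativeIntegral.
Context {R : realType}.
Local Notation leb := (@lebesgue_measure R).

Lemma Rintegral_ge0_eq0 (G : R -> R) (a b : R) : continuous G ->
  (forall t, 0 <= G t) -> Rintegral leb `[a, b] G = 0 ->
  forall t, a < t < b -> G t = 0.
Proof.
move=> cG G0 IG t /andP[at_ tb]; apply/eqP; rewrite eq_le G0 andbT leNgt.
apply/negP => Gt.
have /cvgrPdist_lt : G x @[x --> t] --> G t by exact: cG.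
move=> /(_ (G t / 2)); rewrite divr_gt0// => /(_ isT) /nbhs_ballP[d /= d0 h].
pose e := Num.min (d / 2) (Num.min (t - a) (b - t)).
have e0 : 0 < e by rewrite !lt_min divr_gt0//= !subr_gt0 at_.
have ed : e <= d / 2 by rewrite ge_min lexx.
have ea : e <= t - a by rewrite !ge_min lexx orbT.
have eb : e <= b - t by rewrite !ge_min lexx !orbT.
have low x : t - e <= x <= t + e -> G t / 2 <= G x.
  move=> /andP[x1 x2].
  have xd : ball t d x by rewrite /ball /= ltr_norml; apply/andP; split; lra.
  by have := h x xd; rewrite /= ltr_norml => /andP[? ?]; lra.
have pos : ((G t / 2 * (2 * e))%:E <= \int[leb]_(x in `[a, b]) (G x)%:E)%E.
  apply: (@le_trans _ _ 
      (\int[leb]_(x in `[(t - e)%R, (t + e)%R]) (cst (G t / 2)%:E x))%E).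
    rewrite integral_cst//= lebesgue_measure_itv/= lte_fin.
    have -> : t - e < t + e by lra.
    by rewrite -EFinB -EFinM lee_fin ler_pM2l ?divr_gt0//; lra.
  apply: (@le_trans _ _ (\int[leb]_(x in `[(t - e)%R, (t + e)%R]) (G x)%:E)%E).
    apply: ge0_le_integral => //.
    - by move=> x _; rewrite lee_fin divr_ge0// ltW.
    - by apply/measurable_EFinP; apply: measurable_funTS; exact: continuous_measurable_fun.
  apply: ge0_subset_integral => //.
  - by apply/measurable_EFinP; apply: measurable_funTS; exact: continuous_measurable_fun.
  - by move=> x _; rewrite lee_fin.
  - by move=> x /=; rewrite !in_itv/= => /andP[? ?]; apply/andP; split; lra.
have fin : (\int[leb]_(x in `[a, b]) (G x)%:E)%E \is a fin_num.
  by apply: integrable_fin_num => //; exact: continuous_segment_integrable.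
move: pos; rewrite -(fineK fin) -[fine _]/(Rintegral leb `[a, b] G) IG lee_fin.
by rewrite leNgt mulr_gt0 ?divr_gt0// mulr_gt0.
Qed.

(** Such a polynomial vanishes at every [1 / (k + 2)]. *)
Lemma poly_eq0_cos (p : {poly R[i]}) :
  (forall t, 0 < t < pi -> p.[(cos t)%:C] = 0) -> p = 0.
Proof.
move=> p0; apply/eqP/negPn/negP => pn0.
pose f (k : nat) : R[i] := (k.+2%:R^-1 : R)%:C.
have finj : injective f.
  move=> k l /complexI/invr_inj/eqP; rewrite eqr_nat => /eqP.
  by move=> [].
have := @max_poly_roots _ p (map f (iota 0 (size p))) pn0.
rewrite map_inj_uniq// iota_uniq size_map size_iota ltnn => H.
suff : false by [].
apply: H => //; apply/allP => x /mapP[k _ ->]; rewrite /root /f.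
have k1 : -1 < (k.+2%:R^-1 : R) < 1.
  apply/andP; split; first by rewrite (lt_trans (ltrN10 R))// invr_gt0.
  by rewrite invf_lt1// ltr1n.
have /andP[k1a k1b] := k1.
rewrite -[k.+2%:R^-1 : R](@acosK R) ?in_itv/= ?ltW//.
by rewrite p0// acos_gt0 ?acos_ltpi// ?k1b ?k1a ?ltW.
Qed.

End NonnegativeIntegral.

Section OrthogonalPolynomial.
Context {R : realType}.
Variables (rho : {poly R})
  (mu : {finite_measure set (measurableTypeR R) -> \bar R})
  (r : R) (s : seq R[i]).

Local Notation leb := (@lebesgue_measure R).

Hypothesis rho_gt0 : forall x : R, -1 <= x <= 1 -> 0 < rho.[x].
Hypothesis muE : forall A : set (measurableTypeR R), measurable A ->
  mu A = (\int[leb]_(x in A `&` `[(-1)%R, 1%R]) (weight rho x)%:E)%E.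
Hypothesis r0 : r != 0.
Hypothesis rhoE : map_poly (real_complex R) rho =
  r%:C *: \prod_(x <- s) ('X - x%:P).

Definition outer_poly : {poly R[i]} := \prod_(a <- inner_roots s) (1 - a *: 'X).

Lemma outer_polyE w : outer_poly.[w] = outer s w.
Proof.
rewrite /outer_poly horner_prod; apply: eq_bigr => a _.
by rewrite hornerD hornerC hornerN hornerZ hornerX.
Qed.

Lemma size_outer_poly : (size outer_poly <= (size s).+1)%N.
Proof.
rewrite /outer_poly -(size_map (@inner R) s) -/(inner_roots s).
elim: (inner_roots s) => [|a l IH]; first by rewrite big_nil size_poly1.
rewrite big_cons (leq_trans (size_polyMleq _ _))//.
have h2 : (size (1 - a *: 'X)%R <= 2)%N.
  rewrite (leq_trans (size_polyD _ _))// size_polyN geq_max size_poly1 /=.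
  by rewrite (leq_trans (size_scale_leq _ _))// size_polyX.
by rewrite -subn1 leq_subLR add1n; exact: (leq_add h2 IH).
Qed.

Lemma outer_poly0 : outer_poly`_0 = 1.
Proof.
rewrite -horner_coef0 outer_polyE /outer big1// => a _.
by rewrite mulr0 subr0.
Qed.

Lemma disc_outerV : disc_alg (fun u => (outer s u)^-1).
Proof.
have : all [in inner_roots s] (inner_roots s) by apply/allP.
rewrite /outer; elim: {-1}(inner_roots s) => [|a l IH] /=.
  by move=> _; apply: disc_ext (disc_cst 1) => u; rewrite big_nil invr1.
move=> /andP[al /IH dl].
apply: disc_ext (discM (disc_geom (inner_roots_lt1 r0 rhoE rho_gt0 al)) dl) => u.
by rewrite big_cons invfM.
Qed.

Lemma outer_circ_neq0 (t : R) : outer s (circ t) != 0.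
Proof. by rewrite (outer_neq0 r0 rhoE rho_gt0)// normc_circ. Qed.

(** Divided by [rho], the integrand is [f u + f u^-1] where
    [f u = u * g u / outer u], with [g] a polynomial, is analytic in the disc
    and vanishes at the origin: both halves have mean zero. *)
Lemma bernstein_szego_orthogonal n (q : {poly R[i]}) : ((size s).+2 <= n)%N ->
  (size q <= n)%N ->
  poly_integral mu (bernstein_szego outer_poly (size s) n * q) = 0.
Proof.
move=> sn qn; rewrite (poly_integral_cos rho_gt0 muE).
set C := outer_const r s.
have C0 : C != 0 := outer_const_neq0 s r0.
pose f u : R[i] := u * (pull_infinity n.-1 q).[u] * (outer s u)^-1.
have df : disc_alg f.
  apply: discM disc_outerV; apply: discM; last exact: disc_poly.
  by apply: disc_ext (disc_poly 'X) => u; rewrite hornerX.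
have cf : ccont (fun t => f (circ t)).
  apply: ccontM.
    by apply: ccontM; [exact: ccont_circ|exact/ccont_poly/ccont_circ].
  apply: ccontV => [t|]; first exact: outer_circ_neq0.
  have := ccont_poly outer_poly (@ccont_circ R).
  by under eq_fun do rewrite outer_polyE.
have cfN : ccont (fun t => f (circ (- t))).
  by apply: (@ccont_comp _ (fun t => f (circ t))) => //; exact: opp_continuous.
have n0 : (0 < n)%N by apply: leq_trans sn.
have E (t : R) : (bernstein_szego outer_poly (size s) n * q).[(cos t)%:C]
    / (rho.[cos t])%:C = (2 ^- n / C) * (f (circ t) + f (circ (- t))).
  rewrite (rho_cos rhoE) -/C -joukowski_circ hornerM.
  rewrite (bernstein_szego_joukowski size_outer_poly sn (circ_neq0 t)).
  rewrite !outer_polyE circV /f.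
  set Q := q.[_]; set u := circ t; set v := circ (- t).
  have uv : u * v = 1 by rewrite /u /v -circV divff ?circ_neq0.
  have XX (x y : R[i]) : x * y = 1 -> x ^+ n * y ^+ n.-1 = x.
    by move=> xy; rewrite -{1}(prednK n0) exprS -mulrA -exprMn xy expr1n mulr1.
  have Qu : u ^+ n * Q = u * (pull_infinity n.-1 q).[u].
    rewrite /Q -joukowskiV circV.
    rewrite (@pull_infinityP R n.-1 q v) ?prednK ?circ_neq0// circV opprK -/u.
    by rewrite mulrA XX.
  have Qv : u ^- n * Q = v * (pull_infinity n.-1 q).[v].
    rewrite /Q (@pull_infinityP R n.-1 q u) ?prednK ?circ_neq0// circV -/v.
    by rewrite -exprVn circV -/v mulrA XX// mulrC.
  rewrite -Qu -Qv.
  have Ou : outer s u != 0 := outer_circ_neq0 t.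
  have Ov : outer s v != 0 := outer_circ_neq0 (- t).
  have tn : (2 : R[i]) ^+ n != 0 by rewrite expf_neq0 ?pnatr_eq0.
  have un : u ^+ n != 0 by rewrite expf_neq0 ?circ_neq0.
  move: (outer s u) (outer s v) ((2 : R[i]) ^+ n) (u ^+ n) Ou Ov tn un C0.
  move=> a b c d a0 b0 c0 d0 C0.
  by field; rewrite a0 b0 c0 d0 C0.
rewrite (eq_cint _ _ E) cintZ; last exact: ccontD.
rewrite cintD// disc_mean_value_conj// disc_mean_value//.
by rewrite /f mul0r mul0r mulr0 addr0 !mulr0.
Qed.

Lemma poly_integralB (p q : {poly R[i]}) :
  poly_integral mu (p - q) = poly_integral mu p - poly_integral mu q.
Proof.
have cp (f : {poly R[i]}) :
    ccont (fun t : R => f.[(cos t)%:C] / (rho.[cos t])%:C).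
  apply: ccontM; first exact/ccont_poly/ccontR/continuous_cos.
  apply: ccontV => [t|].
    by rewrite (inj_eq (@complexI R) _ 0) gt_eqF// rho_gt0 ?cos_pm1.
  apply: ccontR => t; apply: (@continuous_comp _ _ _ cos (horner rho)).
    exact: continuous_cos.
  exact: continuous_hornerR.
rewrite !(poly_integral_cos rho_gt0 muE) -mulrBr -cintB//.
by congr (_ * _); apply: eq_cint => t; rewrite hornerD hornerN mulrBl.
Qed.

(** [p] integrated against its conjugate has integrand [|p|^2] on the real
    line, so positivity of the weight forces [p] to vanish on the interval. *)
Lemma orthogonal_to_conj_eq0 (p : {poly R[i]}) :
  poly_integral mu (p * map_poly conjc p) = 0 -> p = 0.
Proof.
rewrite (poly_integral_cos rho_gt0 muE) => /eqP.
rewrite mulf_eq0 invr_eq0 pnatr_eq0 /= => /eqP H.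
pose G t := normc p.[(cos t)%:C] ^+ 2 / rho.[cos t].
have [cr ci] : ccont (fun t : R => p.[(cos t)%:C]).
  exact/ccont_poly/ccontR/continuous_cos.
have cG : continuous G.
  rewrite /G; under eq_fun do rewrite normc_sqr.
  apply: contM.
    by apply: contD; under eq_fun do rewrite expr2; exact: contM.
  apply: contV => t; first by rewrite gt_eqF// rho_gt0 ?cos_pm1.
  by apply: (@continuous_comp _ _ _ cos (horner rho));
    [exact: continuous_cos|exact: continuous_hornerR].
have G0 t : 0 <= G t.
  by rewrite divr_ge0 ?sqr_ge0// ltW// rho_gt0 ?cos_pm1.
have E (t : R) : (p * map_poly conjc p).[(cos t)%:C] / (rho.[cos t])%:C = (G t)%:C.
  rewrite hornerM -[X in (map_poly _ _).[X]](conjc_real (cos t)) horner_map /=.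
  rewrite /G rmorphM fmorphV; congr (_ / _).
  by rewrite rmorphXn /= -norm_normc sqr_normc.
have IG : Rintegral leb `[- pi, pi] G = 0.
  by move: H; rewrite (eq_cint _ _ E) => /(congr1 (@Re R)).
apply: poly_eq0_cos => t /andP[t0 tpi].
have Gt : G t = 0.
  apply: (Rintegral_ge0_eq0 cG G0 IG).
  by rewrite tpi andbT (lt_trans _ t0)// oppr_lt0 pi_gt0.
apply: eq0_normc; apply/eqP.
move/eqP: Gt; rewrite /G mulf_eq0 invr_eq0 sqrf_eq0 => /orP[//|].
by rewrite gt_eqF// rho_gt0 ?cos_pm1.
Qed.

Lemma monic_size_sub n (p : {poly R[i]}) : p \is monic -> size p = n.+1 ->
  (size (p - 'X^n)%R <= n)%N.
Proof.
move=> mp sp; apply/leq_sizeP => j nj; rewrite coefB coefXn.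
move: nj; rewrite leq_eqVlt => /predU1P[<-|nj].
  move/monicP: mp; rewrite lead_coefE sp /= => ->.
  by rewrite eqxx subrr.
by rewrite nth_default ?sp// gtn_eqF// subrr.
Qed.

(** Two monic polynomials of degree [n] differ by a polynomial of smaller
    degree; if both are orthogonal, the difference is orthogonal to its own
    conjugate. *)
Lemma monic_orthogonal_unique n (p : {poly R[i]}) : ((size s).+2 <= n)%N ->
  monic_orthogonal mu n p -> p = bernstein_szego outer_poly (size s) n.
Proof.
move=> sn [mp sp po]; apply/eqP; rewrite -subr_eq0; apply/eqP.
set b := bernstein_szego _ _ _.
have sd : (size (p - b)%R <= n)%N.
  rewrite (_ : p - b = (p - 'X^n) - (b - 'X^n)); last by rewrite opprB addrA subrK.
  rewrite (leq_trans (size_polyD _ _))// size_polyN geq_max monic_size_sub//.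
  exact: (bernstein_szego_monic size_outer_poly outer_poly0).
apply: orthogonal_to_conj_eq0.
have sq : (size (map_poly conjc (p - b)) <= n)%N.
  by rewrite (leq_trans (size_poly _ _)).
by rewrite mulrBl poly_integralB po// bernstein_szego_orthogonal// subrr.
Qed.

End OrthogonalPolynomial.

(** * Integration along segments *)
Section SegmentIntegral.
Context {R : realType}.

Lemma is_derive_poly_segment (F : {poly R[i]}) (a d : R[i]) (s : R) :
  is_derive s (1 : R) (fun s => Re F.[a + s%:C * d])
    (Re (d * F^`().[a + s%:C * d])) /\
  is_derive s (1 : R) (fun s => Im F.[a + s%:C * d])
    (Im (d * F^`().[a + s%:C * d])).
Proof.
elim/poly_ind: F => [|p c [IHr IHi]].
  split; under eq_fun do rewrite horner0; rewrite deriv0 horner0 mulr0;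
  exact: is_derive_cst.
have dr : is_derive s (1 : R) (fun s => Re (a + s%:C * d)) (Re d).
  under eq_fun do rewrite cReD cReM /= mul0r subr0.
  by apply: is_derive_eq; rewrite /GRing.scale /=; ring.
have di : is_derive s (1 : R) (fun s => Im (a + s%:C * d)) (Im d).
  under eq_fun do rewrite cImD cImM /= mul0r addr0.
  by apply: is_derive_eq; rewrite /GRing.scale /=; ring.
rewrite derivD derivM derivX derivC addr0 mulr1 hornerD hornerM hornerX.
split; under eq_fun do rewrite hornerMXaddC ?cReD ?cImD ?cReM ?cImM.
  apply: is_derive_eq; rewrite /GRing.scale /=.
  by rewrite !(cReM, cImM, cReD, cImD); ring.
apply: is_derive_eq; rewrite /GRing.scale /=.
by rewrite !(cReM, cImM, cReD, cImD); ring.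
Qed.

Lemma segment_integral_poly (F : {poly R[i]}) (a b : R[i]) :
  segment_integral a b (fun t => F^`().[t]) = F.[b] - F.[a].
Proof.
rewrite /segment_integral.
have cl : ccont (fun s : R => a + s%:C * (b - a)).
  apply: ccontD; first exact: ccont_cst.
  apply: ccontM; last exact: ccont_cst.
  by apply: ccontR => s; exact: cvg_id.
have cg : ccont (fun s : R => (b - a) * F^`().[a + s%:C * (b - a)]).
  by apply: ccontM; [exact: ccont_cst|exact: ccont_poly].
rewrite -cintZ; last exact: ccont_poly.
have [cr ci] := cg.
have e1 : a + (1 : R)%:C * (b - a) = b by rewrite mul1r addrC subrK.
have e0 : a + (0 : R)%:C * (b - a) = a by rewrite mul0r addr0.
apply: complex_eq.
  rewrite cReD cReN /= (Rintegral_FTC ltr01 cr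
    (fun s => (is_derive_poly_segment F a (b - a) s).1)).
  by rewrite e0 e1.
rewrite cImD cImN /= (Rintegral_FTC ltr01 ci
  (fun s => (is_derive_poly_segment F a (b - a) s).2)).
by rewrite e0 e1.
Qed.

End SegmentIntegral.

(** * The Riemann sphere *)
Section Sphere.
Context {R : realType}.
Implicit Types (z u w : R[i]).

(** Squares rather than discs, because a square is the continuous image of a
    product of two segments. *)
Definition square (M : R) : set R[i]^o :=
  [set z : R[i] | - M <= Re z <= M /\ - M <= Im z <= M].

Lemma complex_eps (eps : R[i]) : 0 < eps -> exists2 e : R, 0 < e & eps = e%:C.
Proof.
case: eps => e f; rewrite ltcE /= => /andP[/eqP fe e0].
by exists e => //; rewrite fe.
Qed.

Lemma continuous_complex_pair :
  continuous ((fun p : R * R => p.1 +i* p.2) : R * R -> R[i]^o).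
Proof.
move=> p; apply/(@cvgrPdist_lt R[i] R[i]^o) => eps /complex_eps[e e0 ->].
have e2 : 0 < e / 2 by rewrite divr_gt0.
near=> q.
rewrite norm_normc ltcR (le_lt_trans (normc_le_ReIm _))// [ltRHS]splitr.
rewrite cReD cImD cReN cImN /=.
rewrite ltrD//; near: q.
  have c1 : q.1 @[q --> p] --> p.1 by exact: cvg_fst.
  by move/cvgrPdist_lt: c1; apply.
have c2 : q.2 @[q --> p] --> p.2 by exact: cvg_snd.
by move/cvgrPdist_lt: c2; apply.
Unshelve. all: by end_near. Qed.

Lemma compact_square M : compact (square M).
Proof.
have -> : square M = (fun p : R * R => p.1 +i* p.2) @` (`[- M, M] `*` `[- M, M]).
  apply/seteqP; split=> [z [zr zi]|_ [[x y] [/= xM yM] <-]].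
    by exists (Re z, Im z); rewrite /= ?in_itv//; case: z {zr zi}.
  by move: xM yM; rewrite !in_itv.
apply: continuous_compact.
  exact/continuous_subspaceT/continuous_complex_pair.
by apply: compact_setX; exact: segment_compact.
Qed.

Lemma closed_square M : closed (square M).
Proof.
by apply: compact_closed (@compact_square M); exact: norm_hausdorff.
Qed.

Lemma nbhs_infinity (M : R) (A : set (riemann_sphere R)) :
  A None -> (forall z : R[i], M < normc z -> A (Some z)) ->
  nbhs (None : riemann_sphere R) A.
Proof.
move=> A0 AM; exists (square M) => /=.
  by split; [exact: compact_square|exact: closed_square].
move=> [z|//] [] // [z' zM [<-]]; apply: AM; apply: contra_notT zM.
rewrite -leNgt => zM; rewrite /square /= -!ler_norml.
by rewrite !(le_trans _ zM) ?normc_Re ?normc_Im.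
Qed.

(** The focal sum at [-1] and [1], constant on the ellipses
    [|u| = constant] of the Joukowski map. *)
Definition focal_sum z : R := normc (z - 1) + normc (z + 1).

Lemma focal_sum_joukowski u : u != 0 ->
  focal_sum (joukowski u) = normc u + (normc u)^-1.
Proof.
move=> u0; rewrite /focal_sum.
have u1 : 0 < normc u by rewrite normc_gt0.
have E1 : joukowski u - 1 = (u - 1) ^+ 2 / (2 * u) by rewrite /joukowski; field.
have E2 : joukowski u + 1 = (u + 1) ^+ 2 / (2 * u) by rewrite /joukowski; field.
have n2 : normc (2 : R[i]) = 2.
  by rewrite -[2](rmorph_nat (real_complex R)) normcR ger0_norm.
rewrite E1 E2 !(normcM, normcV, normcX) n2 !normc_sqr.
rewrite !cReD !cImD !cReN !cImN /=.
have h : normc u ^+ 2 = Re u ^+ 2 + Im u ^+ 2 := normc_sqr u.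
rewrite -mulrDl (_ : _ + _ = 2 * (normc u ^+ 2 + 1)); last by rewrite h; ring.
by field; rewrite gt_eqF.
Qed.

Lemma focal_sum_gt2 z : ~ interval_pm1 z -> 2 < focal_sum z.
Proof.
move=> zI; have u1 := phi_gt1 zI; have [u0 Ju] := phi_neq0_joukowski z.
rewrite -Ju focal_sum_joukowski//; move: u1; set t := normc _ => t1.
have t0 : 0 < t by apply: lt_trans t1.
by rewrite -(ltr_pM2l t0) [ltRHS]mulrDr divff ?gt_eqF//; nra.
Qed.

Lemma focal_sum_lip z w : focal_sum z <= focal_sum w + 2 * normc (w - z).
Proof.
rewrite /focal_sum.
have h c : normc (z - c) <= normc (w - c) + normc (w - z).
  rewrite (_ : z - c = (w - c) - (w - z)); last by ring.
  exact: le_normc_sub.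
have h1 := h 1; have h2 := h (- 1); rewrite !opprK in h2.
lra.
Qed.

Lemma focal_sum_ge z : 2 * normc z <= focal_sum z.
Proof.
rewrite /focal_sum.
have -> : 2 * normc z = normc ((z - 1) + (z + 1)).
  rewrite (_ : _ + _ = (2 : R)%:C * z); last by rewrite rmorph_nat; ring.
  by rewrite normcM normcR ger0_norm.
exact: le_normcD.
Qed.

(** A compact set missing the slit stays off a full ellipse with foci at the
    ends of the slit, whose preimage is a circle of radius larger than one. *)
Lemma compact_exterior (K : set (riemann_sphere R)) : compact K ->
  K `<=` ~` [set Some z | z in @interval_pm1 R] ->
  exists2 q : R, 0 <= q < 1 & forall u : riemann_sphere R, exterior_disc u ->
    K (sphere_joukowski u) -> normc (sphere_inv u) <= q.
Proof.
move=> /compact_near_coveringP cK KI.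
pose P (n : nat) (x : riemann_sphere R) : Prop :=
  if x is Some v then 2 + n.+1%:R^-1 < focal_sum v else True.
have [|N _ NK] := cK nat \oo P _.
  move=> [v|] Kv.
  - have v2 : 2 < focal_sum v.
      by apply: focal_sum_gt2 => vI; apply: (KI _ Kv); exists v.
    pose e := (focal_sum v - 2) / 4; have e0 : 0 < e by rewrite divr_gt0 ?subr_gt0.
    exists (Some @` [set w : R[i]^o | normc (v - w) < e],
            [set n | n.+1%:R^-1 < e]); last first.
      move=> [x n] [/= [w vw <-] ne]; rewrite /P.
      have := focal_sum_lip v w; rewrite -normcN opprB => h.
      have e4 : e * 4 = focal_sum v - 2 by rewrite /e divfK.
      clearbody e; move: (focal_sum v) (focal_sum w) (normc _) (n.+1%:R^-1 : R) e0 vw ne h e4.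
      by move=> a b c d; lra.
    split=> /=.
      apply: (@one_point_compactification_some_nbhs R[i]^o).
      apply/nbhs_ballP; exists e%:C; first by rewrite /= ltcR.
      by move=> w; rewrite /ball /= norm_normc ltcR.
    exists (Num.truncn e^-1) => // n /= hn.
    rewrite invf_plt ?posrE ?ltr0n//.
    by rewrite (lt_le_trans (truncnS_gt _))// ler_nat.
  - exists ([set x | if x is Some w then 3 < focal_sum w else True], setT).
      split => /=; last exact: filterT.
      apply: (@nbhs_infinity (3 / 2)) => // z hz.
      by apply: lt_le_trans (focal_sum_ge z); lra.
    move=> [[w|] n] [/= hw _] //; rewrite /P; apply: le_lt_trans hw.
    have h : n.+1%:R^-1 <= 1 :> R by rewrite invf_le1 ?ltr0n// ler1n.
    by rewrite (_ : 3 = 2 + 1 :> R) ?lerD2l// -natr1.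
have {}NK := NK N (leqnn N).
pose c : R := N.+1%:R^-1; have c0 : 0 < c by rewrite invr_gt0 ltr0n.
exists (1 + c)^-1.
  by rewrite invr_ge0 addr_ge0 ?(ltW c0)//= invf_lt1 ?ltrDl// addr_gt0.
move=> [u|] u1 Ku; last by rewrite /sphere_inv normc0 invr_ge0 addr_ge0 ?(ltW c0).
rewrite /exterior_disc /= in u1; rewrite /sphere_inv.
have {}u1 : 1 < normc u by move: u1; rewrite norm_normc -(rmorph1 (real_complex R)) ltcR.
have u0 : u != 0 by rewrite -normc_gt0 (lt_trans _ u1).
have : 2 + c < focal_sum (joukowski u) := NK _ Ku.
rewrite focal_sum_joukowski// => h.
have ui : (normc u)^-1 < 1 by rewrite invf_lt1// (lt_trans ltr01).
rewrite normcV lef_pV2 ?posrE ?addr_gt0 ?(lt_trans ltr01 u1)//; lra.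
Qed.

Lemma poly_continuous0 (p : {poly R[i]}) (eps : R) : 0 < eps ->
  exists2 d : R, 0 < d & forall w, normc w <= d -> normc (p.[0] - p.[w]) <= eps.
Proof.
move=> eps0; elim/poly_ind: p => [|p c _].
  by exists 1 => // w _; rewrite !horner0 subr0 normc0 ltW.
have [M M0 pM] := poly_disc_bounded p.
have M1 : 0 < M + 1 by rewrite ltr_pwDr.
exists (Num.min 1 (eps / (M + 1))) => [|w]; first by rewrite lt_min ltr01 divr_gt0.
rewrite le_min => /andP[w1 we].
rewrite !hornerMXaddC mulr0 add0r opprD addrCA subrr addr0 normcN normcM.
rewrite (le_trans (ler_pM (normc_ge0 _) (normc_ge0 _) (pM _ w1) we))//.
by rewrite mulrA ler_pdivrMr// mulrC ler_pM2l// lerDl.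
Qed.

Lemma continuous_sphere_poly (p : {poly R[i]}) :
  {for (None : riemann_sphere R),
    continuous ((fun x : riemann_sphere R => p.[sphere_inv x]) :
      riemann_sphere R -> R[i]^o)}.
Proof.
apply/(@cvgrPdist_le R[i] R[i]^o _ (nbhs (None : riemann_sphere R))
  (nbhs_filter _)).
move=> eps /complex_eps[e e0 ->]; have [d d0 pd] := poly_continuous0 p e0.
apply: (@nbhs_infinity d^-1) => [|z zd] /=; rewrite norm_normc lecR pd//.
  by rewrite normc0 ltW.
by rewrite normcV invf_ple ?posrE ?ltW// (lt_trans _ zd)// invr_gt0.
Qed.

End Sphere.

(** * Asymptotics of the polar polynomials *)
Section Psi.
Context {R : realType}.

(** Only large degrees matter for the limit: below [m.+2] any primitive can
    be used. *)
Definition psi_poly (H : {poly R[i]}) (m n : nat) (p : {poly R[i]}) : {poly R[i]} :=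
  if (m.+2 <= n)%N then bs_psi H m n
  else (2 ^+ n.+1 * n.+1%:R) *: pull_infinity n.+1 (primitive p).

Lemma psi_polyP (H : {poly R[i]}) (m n : nat) (p : {poly R[i]}) :
  (size H <= m.+1)%N -> size p = n.+1 ->
  ((m.+2 <= n)%N -> p = bernstein_szego H m n) ->
  exists2 F : {poly R[i]}, F^`() = p & forall u, u != 0 ->
    F.[joukowski u] = u ^+ n.+1 / (2 ^+ n.+1 * n.+1%:R) * (psi_poly H m n p).[u^-1].
Proof.
move=> sH sp pE; rewrite /psi_poly; case: ifP => [mn|_].
  exists (bs_primitive H m n) => [|u u0].
    by rewrite deriv_bs_primitive// pE.
  exact: bs_primitive_joukowski.
exists (primitive p) => [|u u0]; first exact: deriv_primitive.
rewrite hornerZ mulrA divfK; last by rewrite mulf_neq0 ?expf_neq0 ?pnatr_eq0.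
by apply: pull_infinityP => //; rewrite -sp; exact: size_primitive.
Qed.

Lemma uniform_cvg_complex (A : set (riemann_sphere R))
    (f_ : nat -> riemann_sphere R -> R[i]^o) (f : riemann_sphere R -> R[i]^o) :
  (forall e : R, 0 < e -> exists N, forall n u, (N <= n)%N -> A u ->
     normc (f_ n u - f u) <= e) ->
  {uniform A, f_ @ \oo --> f}.
Proof.
move=> H P /uniform_nbhs[E [entE sub]].
move: entE; rewrite -entourage_ballE => -[eps /= /complex_eps[e e0 ->] eE].
have e2 : 0 < e / 2 by rewrite divr_gt0.
have [N HN] := H _ e2.
exists N => // n /= Nn; apply: sub => u Au; apply: eE.
rewrite /ball /= norm_normc ltcR -normcN opprB.
by rewrite (le_lt_trans (HN n u Nn Au))// ltr_pdivrMr// mulr_natr mulr2n ltrDl.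
Qed.

End Psi.

(* Psi n lives on the sphere so that K may contain infinity; the continuity
   clause says that Psi n None is the limit of Psi n at infinity. *)
Theorem lemma21 (R : realType) (m : nat) (rho : {poly R})
    (mu : {finite_measure set (measurableTypeR R) -> \bar R})
    (zeta : R[i]) (P Q : nat -> {poly R[i]})
    (hmu : in_P_muT m rho mu)
    (hzeta : ~ interval_pm1 zeta)
    (hP : forall n : nat, monic_orthogonal mu n (P n))
    (hQ : forall n : nat, polar_polynomial mu zeta n (P n) (Q n)) :
  exists Psi : nat -> riemann_sphere R -> R[i]^o,
    [/\ forall (n : nat) (u : R[i]), 1 < `|u| ->
          (joukowski u - zeta) * (Q n).[joukowski u] =
            u ^+ n.+1 / (2 ^+ n.+1 * n.+1%:R) * Psi n (Some u)
            - phi zeta ^+ n.+1 / (2 ^+ n.+1 * n.+1%:R)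
              * Psi n (Some (phi zeta)),
        forall n : nat, {for (None : riemann_sphere R), continuous (Psi n)} &
        forall K : set (riemann_sphere R),
          compact K ->
          K `<=` ~` [set Some z | z in @interval_pm1 R] ->
          {uniform [set u | exterior_disc u /\ K (sphere_joukowski u)],
            Psi @ \oo --> (psi_limit rho : riemann_sphere R -> R[i]^o)}].
Proof.
have [[r [nu [r0 rhoE']]] rho_ge0' muE'] := hmu.
pose s := [seq nu i | i <- enum 'I_m].
have sm : size s = m by rewrite size_map size_enum_ord.
have rhoE : map_poly (real_complex R) rho = r%:C *: \prod_(x <- s) ('X - x%:P).
  by rewrite rhoE' big_map big_enum.
have rho0 : rho != 0.
  apply/eqP => rho0; move: rhoE; rewrite rho0 rmorph0 => /esym/eqP.
  rewrite scaler_eq0 (inj_eq (@complexI R) _ 0) (negPf r0) /=.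
  by rewrite (negPf (monic_neq0 (monic_prod_XsubC _ _ _))).
have rho_gt : forall x : R, -1 <= x <= 1 -> 0 < rho.[x].
  by apply: (rho_gt0 (mu := mu)) => // x x1; apply: rho_ge0'; rewrite in_itv.
pose H := outer_poly s.
have sH : (size H <= m.+1)%N by rewrite -sm size_outer_poly.
pose psi n := psi_poly H m n (P n).
have PE n : (m.+2 <= n)%N -> P n = bernstein_szego H m n.
  by move=> mn; rewrite -sm; apply: (monic_orthogonal_unique rho_gt muE' r0 rhoE);
    rewrite ?sm.
have psiP n := @psi_polyP R H m n (P n) sH ltac:(by case: (hP n)) (PE n).
exists (fun n u => (psi n).[sphere_inv u]); split.
- move=> n u u1; have [F FP FJ] := psiP n.
  have [_ _ ->] := hQ n.
  have u0 : u != 0 by rewrite -normr_gt0 (lt_trans _ u1).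
  (* The base point is itself in the range of the Joukowski map. *)
  have [p0 Jp] := phi_neq0_joukowski zeta.
  by rewrite -FP segment_integral_poly FJ// -{1}Jp FJ.
- by move=> n; exact: continuous_sphere_poly.
- move=> K cK KI; apply: uniform_cvg_complex => e e0.
  have [q q01 qK] := compact_exterior cK KI.
  have [N HN] := @bs_psi_cvg R H m sH q q01 e e0.
  exists (maxn N m.+2) => n u; rewrite geq_max => /andP[Nn mn] [u1 Ku].
  have wq := qK u u1 Ku; have /andP[q0 q1] := q01.
  rewrite /psi /psi_poly mn /psi_limit -mulrA (szego_ratio r0 rhoE rho_gt).
    by rewrite -outer_polyE; exact: HN.
  exact: le_lt_trans q1.
Qed.
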